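(* Let $G=\prod_{i=1}^n K[u_i,t_i]$, where $t_1\geq\cdots\geq t_n\geq 3$. Let $I\subseteq V(G)$ be an independent set with $\mu(I)=\frac{1}{t_n}(1-\varepsilon)>\omega(t_n)$. Then there exist $j\in[n]$ and $a\in[t_j]$ such that \[t_j<\frac{t_n}{1-\varepsilon}\quad\text{and}\quad \mu(I\setminus J_{a,j})<4\varepsilon^{\eta(t_n)}.\]
   Context: $K[u,t]$ is the complete multipartite graph with $t$ partite sets each of size $u$. The direct product $\prod_i G_i$ has vertex set the Cartesian product of the vertex sets, with two vertices adjacent iff adjacent in every coordinate. $\mu$ is the uniform probability measure on $V(G)$. Let $X_i(1),\ldots,X_i(t_i)$ be the partite sets of the $i$-th factor, and $J_{a,j}=\{(x_1,\ldots,x_n)\in V(G):x_j\in X_j(a)\}$. Define $\eta(t)=\dfrac{\log t}{\log(t/(t-1))}$, and for integers $t\geq 3$ define $\omega(3)=37/81-(1/2)(5/81)^{1/\eta(3)}$, $\omega(4)=85/256-(1/3)(7/256)^{1/\eta(4)}$, and $\omega(t)=(4t-3)/t^3$ for $t\geq 5$.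
   Formalization: The conclusion is proved with the alternative that I is exactly some J_{a,j}, because the claim as stated fails there: if I=J_{a,n} then ε=0 and t_j<t_n is impossible; for every other independent set I both strict inequalities are proved as written. *)

(* Defs.v *)
From mathcomp Require Import all_boot all_order all_algebra.
From mathcomp Require Import all_reals exp.

Set Implicit Arguments.
Unset Strict Implicit.
Unset Printing Implicit Defensive.

Import Order.TTheory GRing.Theory Num.Theory.
Local Open Scope ring_scope.

(* The vertex (a, b) of K[u,t] is the b-th vertex of the a-th partite set. *)
Definition Kvertex (u t : nat) : finType := ('I_t * 'I_u)%type.

Definition Kadj (u t : nat) : rel (Kvertex u t) := fun x y => x.1 != y.1.

Definition Kpart (u t : nat) (a : 'I_t) : {set Kvertex u t} :=
  [set x | x.1 == a].

Definition prod_vertex (n : nat) (V : 'I_n -> finType) : finType :=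
  {dffun forall i : 'I_n, V i}.

Definition prod_adj (n : nat) (V : 'I_n -> finType)
    (e : forall i : 'I_n, rel (V i)) : rel (prod_vertex V) :=
  fun x y => [forall i : 'I_n, e i (x i) (y i)].

Definition Gvertex (n : nat) (u t : 'I_n -> nat) : finType :=
  prod_vertex (fun i : 'I_n => Kvertex (u i) (t i)).

Definition Gadj (n : nat) (u t : 'I_n -> nat) : rel (Gvertex u t) :=
  prod_adj (fun i : 'I_n => @Kadj (u i) (t i)).

Definition independent (V : finType) (e : rel V) (I : {set V}) : Prop :=
  forall x y : V, x \in I -> y \in I -> ~~ e x y.

Definition mu (R : realType) (V : finType) (A : {set V}) : R :=
  #|A|%:R / #|V|%:R.

Definition J (n : nat) (u t : 'I_n -> nat) (j : 'I_n) (a : 'I_(t j)) :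
    {set Gvertex u t} :=
  [set x : Gvertex u t | x j \in Kpart (u j) a].

Definition eta (R : realType) (t : nat) : R :=
  ln t%:R / ln (t%:R / (t%:R - 1)).

(* Meaningful only for t >= 3. *)
Definition omega (R : realType) (t : nat) : R :=
  if t == 3%N then 37 / 81 - (1 / 2) * ((5 / 81) `^ (1 / eta R 3))
  else if t == 4%N then 85 / 256 - (1 / 3) * ((7 / 256) `^ (1 / eta R 4))
  else (4 * t%:R - 3) / t%:R ^+ 3.

(* Main.v *)
(** Collapsing every partite set to a point turns [I] into an intersecting family in a product
    space whose coordinates give each value mass at most [p = 1/t_n].  For [eta = eta(t_n)],
    i.e. [(1-p)^eta = p], induction on the coordinates gives the isoperimetric inequality
    [mu A <= (1 - mu B)^eta] for cross-intersecting [A], [B].  Let [x] be the density of the family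
    off a part [J_{a,j}].  Slicing at [j], the inequality yields a gap: when [mu I > omega(t_n)],
    no [x] lies in an interval [[L, H]], and [x < L] already forces the conclusion.

    If every [x] exceeded [H], this would persist under compression of a coordinate value:
    otherwise two cross-intersecting slices would both have measure more than [p].
    A fully compressed family lives on subsets of the coordinates, and by the same gap argument
    all [x] still exceed [H] after shifting towards the heaviest coordinate.  For a shifted
    intersecting family, deleting the heaviest coordinate leaves a 2-intersecting one, and a
    random-walk recursion bounds its measure by [p^2/(1-p) < H], a contradiction. *)

Require Import Defs.
From mathcomp Require Import all_boot all_order all_algebra.
From mathcomp Require Import perm all_reals exp.
From mathcomp Require Import interval_inference convex hoelder.
From mathcomp Require classical_sets.
From mathcomp Require Import ring lra zify.

Set Implicit Arguments.
Unset Strict Implicit.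
Unset Printing Implicit Defensive.

Import Order.TTheory GRing.Theory Num.Theory.
Local Open Scope ring_scope.

(** * Power inequalities *)

Section PowerInequalities.
Variable R : realType.
Implicit Types (eta : R).

Lemma powR_le eta (x y : R) : 0 <= eta -> 0 <= x -> x <= y -> x `^ eta <= y `^ eta.
Proof.
move=> e0 x0 xy; apply: ge0_ler_powR => //; rewrite nnegrE //.
exact: le_trans xy.
Qed.

Lemma powR_lt eta (x y : R) : 0 < eta -> 0 <= x -> x < y -> x `^ eta < y `^ eta.
Proof.
move=> e0 x0 xy; apply: gt0_ltr_powR => //; rewrite nnegrE //.
exact/ltW/(le_lt_trans x0).
Qed.

Lemma powR_invK eta (x : R) : 0 < eta -> 0 <= x -> (x `^ eta^-1) `^ eta = x.
Proof. by move=> e0 x0; rewrite -powRrM mulVf ?gt_eqF// powRr1. Qed.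

Lemma powR_Kinv eta (x : R) : 0 < eta -> 0 <= x -> (x `^ eta) `^ eta^-1 = x.
Proof. by move=> e0 x0; rewrite -powRrM divff ?gt_eqF// powRr1. Qed.

Lemma powRX eta (x : R) k : 0 <= x -> (x ^+ k) `^ eta = (x `^ eta) ^+ k.
Proof.
move=> x0; rewrite -(powR_mulrn k x0) -(powR_mulrn k (powR_ge0 _ _)).
by rewrite powRAC.
Qed.

Lemma powR_convex eta (s x y : R) : 1 <= eta -> 0 <= s <= 1 -> 0 <= x -> 0 <= y ->
  (s * x + (1 - s) * y) `^ eta <= s * x `^ eta + (1 - s) * y `^ eta.
Proof.
move=> e1 /andP[s0 s1] x0 y0.
have := @convex_powR R eta e1 (Itv01 s0 s1) x y.
rewrite !classical_sets.in_setE /= !in_itv /= !andbT => /(_ x0 y0).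
by rewrite !convRE /=.
Qed.

(** Both [x] and [y] lie between [m] and [x + y - m], with complementary weights as convex
    combinations of these endpoints; the two convexity inequalities add up to the claim. *)
Lemma powR_majorization eta (m x y : R) : 1 <= eta -> 0 <= m -> m <= x -> m <= y ->
  x `^ eta + y `^ eta <= m `^ eta + (x + y - m) `^ eta.
Proof.
move=> e1 m0 mx my.
have [xm|xm] := eqVneq x m.
  by rewrite xm (_ : m + y - m = y)//; ring.
have [ym|ym] := eqVneq y m.
  by rewrite ym addrC (_ : x + m - m = x)//; ring.
have mx' : m < x by rewrite lt_neqAle eq_sym xm.
have my' : m < y by rewrite lt_neqAle eq_sym ym.
pose d := x + y - m - m.
have d0 : 0 < d by rewrite /d; lra.
have M0 : 0 <= x + y - m by lra.
have s01 (z : R) : 0 <= z -> z <= d -> 0 <= z / d <= 1.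
  by move=> z0 zd; rewrite ler_pdivlMr// ler_pdivrMr// mul0r mul1r z0.
have yd : 0 <= (y - m) / d <= 1 by apply: s01; rewrite /d; lra.
have xd : 0 <= (x - m) / d <= 1 by apply: s01; rewrite /d; lra.
have := powR_convex e1 yd m0 M0; have := powR_convex e1 xd m0 M0.
have dn : x + y - m - m != 0 by rewrite gt_eqF.
have -> : (x - m) / d * m + (1 - (x - m) / d) * (x + y - m) = y by rewrite /d; field.
have -> : (y - m) / d * m + (1 - (y - m) / d) * (x + y - m) = x by rewrite /d; field.
have E : (x - m) / d + (y - m) / d = 1 by rewrite /d; field.
set a := (x - m) / d in E *; set b := (y - m) / d in E *.
have -> : b = 1 - a by lra.
set A := m `^ _; set B := (x + y - m) `^ _; lra.
Qed.

(* Majorization applied to the pairs (q c2, c1) and (q c1, q c2 + w c1) with q = 1 - w. *)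
Lemma two_point_ineq eta (p w c1 c2 : R) :
  1 <= eta -> 0 <= p <= 1 -> (1 - p) `^ eta = p ->
  0 <= w <= p -> 0 <= c1 <= c2 ->
  (1 - w) * c1 `^ eta + w * c2 `^ eta <= (w * c1 + (1 - w) * c2) `^ eta.
Proof.
move=> e1 /andP[p0 p1] ep /andP[w0 wp] /andP[c10 c12].
have q0 : 0 <= 1 - w by lra.
have m0 : 0 <= (1 - w) * c1 by exact: mulr_ge0.
have c20 := le_trans c10 c12.
have e0 : 0 <= eta by lra.
have m1 : (1 - w) * c1 <= (1 - w) * c2 by exact: ler_wpM2l.
have m2 : (1 - w) * c1 <= c1 by nra.
have := powR_majorization e1 m0 m1 m2.
rewrite (_ : (1 - w) * c2 + c1 - (1 - w) * c1 = w * c1 + (1 - w) * c2); last by ring.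
rewrite !powRM//.
have qw : w <= (1 - w) `^ eta.
  by apply: (le_trans wp); rewrite -ep; apply: powR_le => //; lra.
have c12' : c1 `^ eta <= c2 `^ eta by exact: powR_le.
have c1' := powR_ge0 c1 eta.
move: qw c12' c1'.
set q := (1 - w) `^ _; set a := c1 `^ _; set b := c2 `^ _; set z := (_ + _) `^ _.
nra.
Qed.

(** One coordinate of the isoperimetric induction: [al a] stands for the measure of a slice of the
    first family, [1 - c b] for that of a slice of the second. Agreement counts as meeting only at
    values in [D], and only there may the bound fail for [a = b]. *)
Lemma weighted_power_ineq (V : finType) (w : V -> R) (D : pred V) (al c : V -> R)
    eta (p : R) :
  1 <= eta -> 0 <= p <= 1 -> (1 - p) `^ eta = p ->
  (forall a, 0 <= w a) -> \sum_a w a = 1 -> (forall a, D a -> w a <= p) ->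
  (forall a, 0 <= al a) -> (forall a, 0 <= c a) ->
  (forall a b, ~~ ((a == b) && D a) -> al a <= c b `^ eta) ->
  \sum_a w a * al a <= (\sum_a w a * c a) `^ eta.
Proof.
move=> e1 p01 ep w0 w1 wp al0 c0 H.
have e0 : 0 < eta by lra.
case: (pickP V) => [v0 _|V0]; last first.
  by move: w1; rewrite big_pred0// => /eqP; rewrite eq_sym oner_eq0.
have [b _ bmin] := @Order.TotalTheory.arg_minP _ _ _ v0 xpredT c isT.
have sumE (f : V -> R) : \sum_a w a * f a = w b * f b + \sum_(a | a != b) w a * f a.
  by rewrite (bigD1 b).
have wE : \sum_(a | a != b) w a = 1 - w b by move: w1; rewrite (bigD1 b)//= => <-; ring.
have wb1 : 0 <= 1 - w b by rewrite -wE sumr_ge0.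
have cmean (z : R) : (forall a, a != b -> z <= c a) ->
    w b * c b + (1 - w b) * z <= \sum_a w a * c a.
  move=> cz; rewrite sumE lerD2l -wE mulr_suml.
  by apply: ler_sum => a ab; rewrite ler_wpM2l// cz.
have cb : c b <= \sum_a w a * c a.
  by apply: le_trans (cmean (c b) _) => [|a _]; [lra | exact: bmin].
(* As [b] minimizes [c], either the power of [c b] bounds every [al a], or [al b] alone exceeds
   it. *)
have [alb|alb] := leP (al b) (c b `^ eta).
  apply: (@le_trans _ _ (c b `^ eta)); last by apply: powR_le => //; exact: ltW.
  rewrite -[leRHS]mul1r -w1 mulr_suml; apply: ler_sum => a _.
  rewrite ler_wpM2l//; case: (eqVneq a b) => [->//|ab].
  by apply: H; rewrite (negbTE ab).
have Db : D b.
  by apply: contraTT alb => Db; rewrite -leNgt; apply: H; rewrite eqxx.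
(* This root of [al b] bounds every other [c a] from below, so the two-point inequality for [c b]
   and [d] suffices. *)
pose d := al b `^ eta^-1.
have dE : d `^ eta = al b by rewrite powR_invK.
have cbd : c b <= d.
  rewrite leNgt; apply/negP => /ltW dcb; move: alb; rewrite ltNge -dE.
  by rewrite powR_le ?powR_ge0// ltW.
have dc a : a != b -> d <= c a.
  move=> ab; rewrite leNgt; apply/negP => ad.
  have := powR_lt e0 (c0 a) ad; rewrite dE ltNge H//.
  by rewrite negb_and eq_sym ab.
apply: (@le_trans _ _ ((w b * c b + (1 - w b) * d) `^ eta)); last first.
  apply: powR_le; [exact: ltW | | exact: cmean].
  by rewrite addr_ge0 ?mulr_ge0 ?powR_ge0.
apply: le_trans (two_point_ineq e1 p01 ep _ _); last 2 first.
- by rewrite w0 wp.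
- by rewrite c0.
rewrite dE sumE addrC lerD2r -wE mulr_suml; apply: ler_sum => a ab.
by rewrite ler_wpM2l//; apply: H; rewrite (negbTE ab).
Qed.

End PowerInequalities.

(** * Isoperimetry in product spaces *)

Section ProductMeasure.
Variables (R : realType) (I V : finType).
Local Notation X := {ffun I -> V}.
Implicit Types (w : I -> V -> R) (A B C : {set X}) (x y : X).

Definition wt w x : R := \prod_i w i (x i).
Definition Pr w A : R := \sum_(x in A) wt w x.
Definition prob_weights w :=
  (forall i a, 0 <= w i a) /\ (forall i, \sum_a w i a = 1).
Definition upd x j a : X := [ffun i => if i == j then a else x i].
Definition slice A j a : {set X} := [set x | upd x j a \in A].
Definition coord j a : {set X} := [set x : X | x j == a].

Lemma updE x j a i : upd x j a i = if i == j then a else x i.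
Proof. by rewrite ffunE. Qed.

Lemma upd_same x j a b : upd (upd x j a) j b = upd x j b.
Proof. by apply/ffunP => i; rewrite !ffunE; case: eqP. Qed.

Lemma upd_id x j : upd x j (x j) = x.
Proof. by apply/ffunP => i; rewrite ffunE; case: eqP => // ->. Qed.

(** Cross-multiplied, since [w j (x j)] may vanish. *)
Lemma wt_upd w x j a : w j (x j) * wt w (upd x j a) = w j a * wt w x.
Proof.
rewrite /wt (bigD1 j)//= [in RHS](bigD1 j)//= updE eqxx mulrCA; congr (_ * (_ * _)).
by apply: eq_bigr => i ij; rewrite updE (negbTE ij).
Qed.

Section Weights.
Variable w : I -> V -> R.
Hypothesis w_prob : prob_weights w.
Let w0 : forall i a, 0 <= w i a := w_prob.1.
Let w1 : forall i, \sum_a w i a = 1 := w_prob.2.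

Lemma wt_ge0 x : 0 <= wt w x. Proof. exact: prodr_ge0. Qed.

Lemma Pr_ge0 A : 0 <= Pr w A. Proof. by apply: sumr_ge0 => x _; exact: wt_ge0. Qed.

Lemma Pr_set0 : Pr w set0 = 0. Proof. exact: big_set0. Qed.

Lemma PrID A C : Pr w A = Pr w (A :&: C) + Pr w (A :\: C).
Proof. exact: big_setID. Qed.

Lemma Pr_mono A B : A \subset B -> Pr w A <= Pr w B.
Proof. by move=> /setIidPr AB; rewrite (PrID B A) AB lerDl Pr_ge0. Qed.

Lemma Pr_setT : Pr w setT = 1.
Proof.
rewrite /Pr (eq_bigl xpredT); last by move=> x; rewrite inE.
by rewrite -(bigA_distr_bigA w) big1.
Qed.

Lemma Pr_le1 A : Pr w A <= 1.
Proof. by rewrite -Pr_setT Pr_mono ?subsetT. Qed.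

Lemma Pr_slice A j : Pr w A = \sum_a w j a * Pr w (slice A j a).
Proof.
pose F (q : V * X) := if upd q.2 j q.1 \in A then w j q.1 * wt w q.2 else 0.
transitivity (\sum_q F q); last first.
  rewrite -(pair_bigA _ (fun a x => F (a, x))); apply: eq_bigr => a _.
  rewrite mulr_sumr [in RHS]big_mkcond; apply: eq_bigr => x _.
  by rewrite /F inE.
(* The involution [h] exchanges coordinate [j] with an independent extra sample; afterwards the
   sample no longer affects membership and sums out to 1. *)
pose h (q : V * X) := (q.2 j, upd q.2 j q.1).
have hK : cancel h h by move=> [a x]; rewrite /h /= updE eqxx upd_same upd_id.
rewrite (reindex_inj (can_inj hK)) /=.
rewrite (eq_bigr (fun q : V * X => if q.2 \in A then w j q.1 * wt w q.2 else 0)); last first.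
  by move=> [a x] _; rewrite /F /h /= upd_same upd_id wt_upd.
rewrite -(pair_bigA _ (fun a x => if x \in A then w j a * wt w x else 0)) /=.
under eq_bigr do rewrite -big_mkcond -mulr_sumr.
by rewrite -mulr_suml w1 mul1r.
Qed.

Lemma slice_coord A j a c :
  slice (A :\: coord j a) j c = if c == a then set0 else slice A j c.
Proof.
apply/setP => x; rewrite !inE updE eqxx.
by case: ifP => // _; rewrite !inE.
Qed.

Lemma Pr_off A j a :
  Pr w (A :\: coord j a) = \sum_(c | c != a) w j c * Pr w (slice A j c).
Proof.
rewrite (Pr_slice _ j) [in RHS]big_mkcond; apply: eq_bigr => c _.
by rewrite slice_coord; case: eqP => //; rewrite Pr_set0 mulr0.
Qed.

Lemma Pr_on_off A j a :
  Pr w A = w j a * Pr w (slice A j a) + Pr w (A :\: coord j a).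
Proof. by rewrite Pr_off (Pr_slice A j) (bigD1 a). Qed.

Lemma sum_off j a : \sum_(c | c != a) w j c = 1 - w j a.
Proof. by have := w1 j; rewrite (bigD1 a)//= => <-; rewrite addrAC subrr add0r. Qed.

Lemma Pr_inj (f : X -> X) A B : {in A &, injective f} ->
  (forall x, x \in A -> f x \in B) -> (forall x, x \in A -> wt w x <= wt w (f x)) ->
  Pr w A <= Pr w B.
Proof.
move=> finj fB fw; apply: (@le_trans _ _ (Pr w (f @: A))).
  by rewrite /Pr big_imset//=; apply: ler_sum.
by apply: Pr_mono; apply/subsetP => _ /imsetP[x xA ->]; exact: fB.
Qed.

End Weights.

(** [D] selects the values at which agreement counts: all of them for the original family, only
    [true] once the values are reduced to two. *)
Definition meets (D : I -> pred V) x y := [exists i, (x i == y i) && D i (x i)].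
Definition crossing (D : I -> pred V) A B := [forall x in A, forall y in B, meets D x y].

Lemma crossingP D A B :
  reflect (forall x y, x \in A -> y \in B -> meets D x y) (crossing D A B).
Proof.
apply: (iffP forall_inP) => H x; first by move=> y xA yB; have /forall_inP := H x xA; apply.
by move=> xA; apply/forall_inP => y yB; exact: H.
Qed.

Lemma crossing_slice D A B j a b : a != b -> crossing D A B ->
  crossing D (slice A j a) (slice B j b).
Proof.
move=> ab /crossingP AB; apply/crossingP => x y; rewrite !inE => xA yB.
have /existsP[i] := AB _ _ xA yB; rewrite !updE.
by case: (eqVneq i j) => [_|_ H]; [rewrite (negbTE ab) | apply/existsP; exists i].
Qed.

Section Isoperimetry.
Variables (w : I -> V -> R) (D : I -> pred V) (p eta : R).
Hypothesis w_prob : prob_weights w.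
Hypothesis w_le : forall i a, D i a -> w i a <= p.
Hypothesis eta_ge1 : 1 <= eta.
Hypothesis p_gt0 : 0 < p.
Hypothesis p_lt1 : p < 1.
Hypothesis eta_p : (1 - p) `^ eta = p.

(** Induction on the list [K] of coordinates where members may still meet, in a fixed ambient space:
    slicing at [j] removes [j] from [K], unless both slices are taken at the same value in [D]. For
    empty [K] one of the families is empty. *)
Lemma isoperimetry_seq (K : seq I) A B :
  (forall x y, x \in A -> y \in B -> has (fun i => (x i == y i) && D i (x i)) K) ->
  Pr w A <= (1 - Pr w B) `^ eta.
Proof.
have p01 : 0 <= p <= 1 by rewrite !ltW.
have [w0 w1] := w_prob.
elim: K A B => [|j K IH] A B AB.
  case: (set_0Vmem A) => [->|[x xA]]; first by rewrite Pr_set0 powR_ge0.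
  case: (set_0Vmem B) => [->|[y yB]]; first by rewrite Pr_set0 subr0 powR1 Pr_le1.
  by have := AB x y xA yB.
rewrite (Pr_slice w_prob A j).
have -> : 1 - Pr w B = \sum_b w j b * (1 - Pr w (slice B j b)).
  rewrite (Pr_slice w_prob B j) -{1}(w1 j) -sumrB.
  by apply: eq_bigr => b _; rewrite mulrBr mulr1.
apply: (@weighted_power_ineq _ _ _ (D j) _ _ _ p) => //.
- by move=> a; exact: w_le.
- by move=> a; exact: Pr_ge0.
- by move=> a; rewrite subr_ge0 Pr_le1.
move=> a b ab; apply: IH => x y; rewrite !inE => xA yB.
have /hasP[i iK] := AB _ _ xA yB; rewrite !updE.
case: (eqVneq i j) => [->|ij H]; first by rewrite (negbTE ab).
by apply/hasP; exists i => //; move: iK; rewrite inE (negbTE ij).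
Qed.

Lemma isoperimetry A B : crossing D A B -> Pr w A <= (1 - Pr w B) `^ eta.
Proof.
move=> /crossingP AB; apply: (@isoperimetry_seq (enum I)) => x y xA yB.
by have /existsP[i H] := AB x y xA yB; apply/hasP; exists i; rewrite ?mem_enum.
Qed.

Lemma crossing_not_both A B : crossing D A B -> p <= Pr w B -> Pr w A <= p.
Proof.
move=> AB pB; apply: le_trans (isoperimetry AB) _; rewrite -[leRHS]eta_p.
by apply: powR_le; rewrite ?subr_ge0 ?Pr_le1 ?lerD2l ?lerN2 ?(le_trans ler01 eta_ge1).
Qed.

Lemma intersecting_le A : crossing D A A -> Pr w A <= p.
Proof. by move=> AA; rewrite leNgt; apply/negP => /[dup] /ltW /(crossing_not_both AA); lra. Qed.

(** Every slice at [c != a] cross-intersects the slice at [a], so isoperimetry bounds each of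
    them. *)
Lemma Pr_off_le A j a : crossing D A A ->
  Pr w (A :\: coord j a) <= (1 - w j a) * (1 - Pr w (slice A j a)) `^ eta.
Proof.
move=> AA; rewrite Pr_off// -sum_off// mulr_suml; apply: ler_sum => c ca.
rewrite ler_wpM2l//; first exact: w_prob.1.
by apply: isoperimetry; exact: crossing_slice.
Qed.

End Isoperimetry.
End ProductMeasure.

(** * The gap, and symmetrizations *)

Section Gap.
Variable R : realType.

(* [om] bounds the values at [z = L, H] of the function [z |-> p (1 - z^(1/eta)) + (1 - p) z],
   which is the measure of an intersecting family at the equality case of [Pr_off_le]. *)
Record gap_params (p eta om L H : R) : Prop := GapParams {
  gap_p0 : 0 < p;
  gap_p2 : p <= 1 / 2;
  gap_eta : 1 <= eta;
  gap_eq : (1 - p) `^ eta = p;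
  gap_L0 : 0 < L;
  gap_Hom : H <= om;
  gap_width : p ^+ 2 <= (1 - p) * (H - L);
  gap_atL : p * (1 - L `^ eta^-1) + (1 - p) * L <= om;
  gap_atH : p * (1 - H `^ eta^-1) + (1 - p) * H <= om }.

Variables p eta om L H : R.
Hypothesis gp : gap_params p eta om L H.

Lemma gap_LH : L < H.
Proof.
have := gap_width gp; have := gap_p0 gp; have := gap_p2 gp => p2 p0 w.
have : 0 < p ^+ 2 by rewrite exprn_gt0.
nra.
Qed.

(** Here [v] and [x] are the densities on and off a part of weight [w], and [m] is the total
    measure. The isoperimetric bound inverts to an upper bound on [v]; if [x < m], that bound
    exceeds [x], so raising the weight to [p] only increases the mixture. *)
Lemma off_ratio_le (w v x m : R) : 0 <= w <= p -> v <= 1 -> 0 <= x ->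
  x <= (1 - v) `^ eta -> m = w * v + (1 - w) * x ->
  m <= w * (1 - x `^ eta^-1) + (1 - w) * x /\
  (x < m -> m <= p * (1 - x `^ eta^-1) + (1 - p) * x).
Proof.
move=> /andP[w0 wp] v1 x0 xv mE.
have e0 : 0 < eta by exact: lt_le_trans ltr01 (gap_eta gp).
have yv : x `^ eta^-1 <= 1 - v.
  rewrite -[leRHS](@powR_Kinv _ eta) ?subr_ge0//.
  by apply: powR_le => //; rewrite invr_ge0 ltW.
have m1 : m <= w * (1 - x `^ eta^-1) + (1 - w) * x by move: yv; set y := _ `^ _ => yv; nra.
split => // xm; move: m1 yv; set y := _ `^ _ => m1 yv.
have [xy|xy] := leP x (1 - y); last by nra.
by have : 0 <= (p - w) * (1 - y - x); [apply: mulr_ge0; lra | lra].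
Qed.

(** The upper bound for [m] is convex, so on [[L, H]] it is at most its larger endpoint value, hence
    at most [om]. *)
Lemma gap_ratio (w v x m : R) : 0 <= w <= p -> v <= 1 -> 0 <= x ->
  x <= (1 - v) `^ eta -> m = w * v + (1 - w) * x -> om < m -> ~~ (L <= x <= H).
Proof.
move=> w01 v1 x0 xv mE omm; apply/negP => /andP[Lx xH].
have e1 := gap_eta gp; have e0 : 0 < eta by exact: lt_le_trans ltr01 e1.
have Hom := gap_Hom gp.
have xm : x < m by lra.
have [_ /(_ xm) {}xm] := off_ratio_le w01 v1 x0 xv mE.
have aL := gap_atL gp; have aH := gap_atH gp; have LH := gap_LH.
have L0 := gap_L0 gp.
set y := x `^ eta^-1 in xm; set l := L `^ eta^-1 in aL; set h := H `^ eta^-1 in aH.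
have k0 : 0 < eta^-1 by rewrite invr_gt0.
have lh : l < h by apply: powR_lt => //; lra.
have ly : l <= y by apply: powR_le => //; exact: ltW.
have yh : y <= h by apply: powR_le => //; exact: ltW.
have lE : l `^ eta = L by rewrite powR_invK// ltW.
have hE : h `^ eta = H by rewrite powR_invK//; lra.
have yE : y `^ eta = x by rewrite powR_invK.
(* Interpolation takes place in the variable [y], in which the bound is linear except for the convex
   power [x]. *)
pose s := (h - y) / (h - l).
have s01 : 0 <= s <= 1.
  rewrite /s ler_pdivlMr ?subr_gt0// ler_pdivrMr ?subr_gt0//.
  by rewrite mul0r mul1r subr_ge0 yh lerD2l lerN2.
have yS : s * l + (1 - s) * h = y by rewrite /s; field; rewrite gt_eqF ?subr_gt0.
have := powR_convex e1 s01 (powR_ge0 _ _ : 0 <= l) (powR_ge0 _ _ : 0 <= h).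
rewrite yS yE lE hE => xc.
clearbody s y l h; clear lE hE yE xv mE.
have p0 := gap_p0 gp; have p2 := gap_p2 gp.
have yS' : y = s * l + (1 - s) * h by [].
case/andP: s01 => s0 s1.
have : (1 - p) * x <= (1 - p) * (s * L + (1 - s) * H) by rewrite ler_wpM2l//; lra.
have : s * (p * (1 - l) + (1 - p) * L) <= s * om by rewrite ler_wpM2l.
have : (1 - s) * (p * (1 - h) + (1 - p) * H) <= (1 - s) * om by rewrite ler_wpM2l// subr_ge0.
rewrite yS' in xm *; lra.
Qed.

End Gap.

(** * Symmetrization along an involution *)

Section Symmetrization.
Variable X : finType.
Implicit Types A : {set X}.

Section Step.
Variables (sg : X -> X) (P : pred X).

(** Common form of compression and shifting: [P] marks the preferred point of an orbit of [sg], and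
    a lone member of such an orbit is moved there. [move_up] records this motion as a map on [A]. *)
Definition symm A : {set X} :=
  [set x | if P x then (x \in A) || (sg x \in A)
           else if P (sg x) then (x \in A) && (sg x \in A) else x \in A].
Definition move_up A x := if P (sg x) && (sg x \notin A) then sg x else x.

Hypothesis sgK : involutive sg.
Hypothesis P_sg : forall x, P x -> ~~ P (sg x).

Lemma move_up_symm A x : x \in A -> move_up A x \in symm A.
Proof.
move=> xA; rewrite /move_up; case: ifP => [/andP[Px nA]|].
  by rewrite inE Px sgK xA orbT.
by rewrite inE xA; case: (P x); case: (P (sg x)); case: (sg x \in A).
Qed.

Lemma move_up_inj A : {in A &, injective (move_up A)}.
Proof.
move=> x y xA yA; rewrite /move_up.
case: ifP => [/andP[_ nx]|_]; case: ifP => [/andP[_ ny]|_] //.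
- exact: (can_inj sgK).
- by move=> xy; rewrite xy yA in nx.
- by move=> xy; rewrite -xy xA in ny.
Qed.

Lemma symmP A x : x \in symm A -> x \in A \/ (P x /\ sg x \in A).
Proof.
rewrite inE; case: ifP => [Px /orP[|]|_]; [by left|by right|].
by case: ifP => [_ /andP[]|]; left.
Qed.

Lemma symm_both A x : x \in symm A -> P (sg x) -> x \in A /\ sg x \in A.
Proof.
move=> /[swap] Px; rewrite inE Px; case: ifP => [/P_sg|_ /andP//].
by rewrite Px.
Qed.

Lemma symm_pot (pot : X -> nat) A x0 :
  (forall x, P (sg x) -> (pot x < pot (sg x))%N) ->
  x0 \in A -> P (sg x0) -> sg x0 \notin A ->
  (\sum_(x in A) pot x < \sum_(x in symm A) pot x)%N.
Proof.
move=> Hpot x0A Px0 nx0.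
apply: (@leq_trans (\sum_(x in A) pot (move_up A x))).
  rewrite (bigD1 x0)//= [ltnRHS](bigD1 x0)//= -addSn leq_add//.
    by rewrite /move_up Px0 nx0 Hpot.
  apply: leq_sum => x _; rewrite /move_up; case: ifP => // /andP[Px _].
  exact/ltnW/Hpot.
rewrite -(big_imset pot (@move_up_inj A)) /=.
apply: (@leq_trans (\sum_(x in symm A | x \in move_up A @: A) pot x)).
  rewrite leq_eqVlt; apply/orP; left; apply/eqP; apply: eq_bigl => x.
  case: imsetP => [[y yA ->]|]; last by rewrite andbF.
  by rewrite move_up_symm.
by rewrite [leqRHS](bigID (mem (move_up A @: A)))/= leq_addr.
Qed.

End Step.

(** Among the sets satisfying [Q], one of maximal total potential is stable, because any step that
    moves a point strictly raises the potential. No order of the operations has to be chosen. *)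
Lemma symm_stable (T : Type) (sg : T -> X -> X) (P : T -> pred X) (pot : X -> nat)
    (Q : pred {set X}) A0 :
  (forall k, involutive (sg k)) -> (forall k x, P k x -> ~~ P k (sg k x)) ->
  (forall k x, P k (sg k x) -> (pot x < pot (sg k x))%N) ->
  (forall k A, Q A -> Q (symm (sg k) (P k) A)) -> Q A0 ->
  exists2 A, Q A & forall k x, x \in A -> P k (sg k x) -> sg k x \in A.
Proof.
move=> sgK Psg Hpot HQ Q0.
pose F (A : {set X}) := (\sum_(x in A) pot x)%N.
have [A QA Amax] := arg_maxnP F Q0.
exists A => // k x xA Px; apply: contraT => nx.
have := symm_pot (sgK k) (Hpot k) xA Px nx.
by rewrite ltnNge; have := Amax _ (HQ k _ QA); rewrite /F /= => ->.
Qed.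

End Symmetrization.

Section SymmetrizationMeasure.
Variables (R : realType) (I V : finType) (w : I -> V -> R).
Hypothesis w_prob : prob_weights w.
Variables (sg : {ffun I -> V} -> {ffun I -> V}) (P : pred {ffun I -> V}).
Hypothesis sgK : involutive sg.
Hypothesis wt_sg : forall x, P (sg x) -> wt w x <= wt w (sg x).

(** [move_up] is injective, never lowers a weight and, by the hypothesis on [C], never carries a
    point into [C]. *)
Lemma Pr_symm_off (A C : {set {ffun I -> V}}) :
  (forall x, P (sg x) -> x \notin C -> sg x \notin C) ->
  Pr w (A :\: C) <= Pr w (symm sg P A :\: C).
Proof.
move=> HC; apply: (@Pr_inj _ _ _ _ _ (move_up sg P A)) => //.
- move=> x y; rewrite !in_setD => /andP[_ xA] /andP[_ yA]; exact: move_up_inj.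
- move=> x; rewrite !in_setD => /andP[xC xA].
  rewrite move_up_symm// andbT /move_up; case: ifP => // /andP[Px _]; exact: HC.
- move=> x _; rewrite /move_up; case: ifP => // /andP[Px _]; exact: wt_sg.
Qed.

Lemma Pr_symm (A : {set {ffun I -> V}}) : Pr w A <= Pr w (symm sg P A).
Proof.
by have := @Pr_symm_off A set0 _; rewrite !setD0; apply => x _; rewrite !inE.
Qed.

End SymmetrizationMeasure.

(** * Compression *)

Section Bad.
Variables (R : realType) (I V : finType).
Implicit Types (A : {set {ffun I -> V}}).

(** Divided by [1 - w j a], this says that the density of [A] conditioned on coordinate [j]
    differing from [a] exceeds [H]. *)
Definition bad (w : I -> V -> R) (H : R) A j a :=
  (1 - w j a) * H < Pr w (A :\: coord j a).

Definition all_bad (D : I -> pred V) w om H A :=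
  [&& crossing D A A, om < Pr w A & [forall j, forall a, D j a ==> bad w H A j a]].

Lemma all_badP D w om H A :
  reflect [/\ crossing D A A, om < Pr w A & forall j a, D j a -> bad w H A j a]
          (all_bad D w om H A).
Proof.
apply: (iffP and3P) => -[AA mA bA]; split => //.
  by move=> j a Dja; have /forallP/(_ a)/implyP := forallP bA j; apply.
by apply/forallP => j; apply/forallP => a; apply/implyP; exact: bA.
Qed.

(** The gap in use: the conditional density off the part is at most [H] and cannot lie in [[L, H]],
    hence is below [L]. *)
Lemma not_bad_off (D : I -> pred V) w (p eta om L H : R) A j a :
  gap_params p eta om L H -> prob_weights w -> (forall i c, D i c -> w i c <= p) ->
  crossing D A A -> om < Pr w A -> w j a <= p -> ~~ bad w H A j a ->
  Pr w (A :\: coord j a) < (1 - w j a) * L.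
Proof.
move=> gp wP wle AA mA wp; rewrite /bad -leNgt => nb.
have p2 := gap_p2 gp; have p0 := gap_p0 gp.
have w1 : 0 < 1 - w j a by lra.
have off := @Pr_off_le _ _ _ _ _ _ _ wP wle (gap_eta gp) p0 (ltac:(lra)) (gap_eq gp) A j a AA.
pose x := Pr w (A :\: coord j a) / (1 - w j a).
have xE : Pr w (A :\: coord j a) = (1 - w j a) * x by rewrite /x mulrC divfK ?gt_eqF.
have x0 : 0 <= x by rewrite divr_ge0 ?Pr_ge0 ?(ltW w1).
have w01 : 0 <= w j a <= p by rewrite wP.1.
rewrite xE ler_pM2l// in off; rewrite xE ler_pM2l// in nb.
have := Pr_on_off wP A j a; rewrite xE => mE.
have := gap_ratio gp w01 (Pr_le1 wP _) x0 off mE mA.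
by rewrite nb andbT -ltNge ltr_pM2l.
Qed.

End Bad.

Section Compression.
Variables (R : realType) (I V : finType) (w : I -> V -> R) (a0 : V).
Variables (p eta om L H : R).
Hypothesis gp : gap_params p eta om L H.
Hypothesis w_prob : prob_weights w.
Hypothesis w_le : forall i a, w i a <= p.
Hypothesis w_a0 : forall i a, w i a <= w i a0.
Local Notation X := {ffun I -> V}.
Local Notation full := (fun (_ : I) (_ : V) => true).
Implicit Types (A : {set X}) (x y : X).

Let p0 := gap_p0 gp.
Let p2 := gap_p2 gp.
Let p1 : p < 1. Proof. by apply: (le_lt_trans p2); lra. Qed.

Definition swap_value (j : I) (b : V) x : X := upd x j (tperm a0 b (x j)).

Lemma swap_valueK j b : involutive (swap_value j b).
Proof.
by move=> x; rewrite /swap_value updE eqxx tpermK upd_same upd_id.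
Qed.

Lemma swap_value_a0 j b x : b != a0 -> (swap_value j b x j == a0) = (x j == b).
Proof.
move=> ba; rewrite updE eqxx.
by case: tpermP => [->|->|/eqP/negbTE -> /eqP/negbTE ->]; rewrite ?eqxx// eq_sym.
Qed.

Lemma meetsC D x y : @meets I V D x y = meets D y x.
Proof. by apply: eq_existsb => i; rewrite eq_sym; case: eqP => // ->. Qed.

(** Two moved points agree at [j]. If a moved point [x] missed an unmoved [y], undo the move of [x]:
    when [y j = b], the swap of [y] is also in [A] and misses the swap of [x]; otherwise [y] itself
    misses it. *)
Lemma crossing_compress j b A : b != a0 -> crossing full A A ->
  crossing full (symm (swap_value j b) (fun x => x j == a0) A)
                (symm (swap_value j b) (fun x => x j == a0) A).
Proof.
move=> ba /crossingP AA.
set sA := symm _ _ A.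
have psg (x : X) : x j == a0 -> ~~ (swap_value j b x j == a0).
  by move=> /eqP xj; rewrite swap_value_a0// xj eq_sym.
have mixed x y : x j == a0 -> swap_value j b x \in A -> y \in sA -> y \in A ->
    meets full x y.
  move=> /eqP xj sx ysA yA; apply: contraT => /existsPn nm.
  have {}nm i : x i != y i by have := nm i; rewrite andbT.
  have [yj|yj] := eqVneq (y j) b.
    have yP : swap_value j b y j == a0 by rewrite swap_value_a0 ?yj.
    have [_ sy] := symm_both psg ysA yP.
    have /existsP[i] := AA _ _ sx sy; rewrite andbT !updE.
    case: (eqVneq i j) => [_|_]; last by rewrite (negbTE (nm i)).
    by rewrite xj yj tpermL tpermR (negbTE ba).
  have /existsP[i] := AA _ _ sx yA; rewrite andbT !updE.
  case: (eqVneq i j) => [->|_]; last by rewrite (negbTE (nm i)).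
  by rewrite xj tpermL eq_sym (negbTE yj).
apply/crossingP => x y xs ys.
have [xA|[xP sx]] := symmP xs; have [yA|[yP sy]] := symmP ys.
- exact: AA.
- by rewrite meetsC; exact: mixed.
- exact: mixed.
- by apply/existsP; exists j; rewrite (eqP xP) (eqP yP) eqxx.
Qed.

Lemma wt_le_upd x j a : w j (x j) <= w j a -> wt w x <= wt w (upd x j a).
Proof.
move=> wa; rewrite /wt (bigD1 j)//= [leRHS](bigD1 j)//= updE eqxx.
rewrite [X in _ <= _ * X](eq_bigr (fun i => w i (x i))); last first.
  by move=> i ij; rewrite updE (negbTE ij).
by rewrite ler_wpM2r//; apply: prodr_ge0 => i _; exact: w_prob.1.
Qed.

Lemma all_bad_compress j b A : b != a0 -> all_bad full w om H A ->
  all_bad full w om H (symm (swap_value j b) (fun x => x j == a0) A).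
Proof.
move=> ba /all_badP[AA mA bA]; set sA := symm _ _ A.
have sK := @swap_valueK j b.
have wt_sg x : swap_value j b x j == a0 -> wt w x <= wt w (swap_value j b x).
  rewrite swap_value_a0// => /eqP xj; apply: wt_le_upd.
  by rewrite xj tpermR.
have sAA : crossing full sA sA by exact: crossing_compress.
have msA : om < Pr w sA by apply: lt_le_trans mA _; exact: Pr_symm.
apply/all_badP; split => // k a _.
(* A moved point acquires only the value [a0] at [j], so badness is at risk for that part alone. *)
have [/andP[/eqP -> /eqP ->]|ka] := boolP ((k == j) && (a == a0)); last first.
  apply: lt_le_trans (bA k a isT) _; apply: Pr_symm_off => // x sx.
  rewrite !inE; case: (eqVneq k j) ka => [-> /= aa0 _|kj _].
    by rewrite (eqP sx) eq_sym.
  by rewrite updE (negbTE kj).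
apply: contraT => nb.
have small := not_bad_off gp w_prob (fun i a _ => w_le i a) sAA msA (w_le _ _) nb.
pose S := Pr w (A :\: coord j a0 :\: coord j b).
have S_small : S <= Pr w (sA :\: coord j a0).
  apply: Pr_mono => //; apply/subsetP => x; rewrite !inE => /and3P[xb xa xA].
  by rewrite xa (negbTE xa) swap_value_a0// (negbTE xb).
have E1 := Pr_on_off w_prob (A :\: coord j a0) j b.
rewrite slice_coord (negbTE ba) -/S in E1.
have E2 := Pr_on_off w_prob (A :\: coord j b) j a0.
rewrite slice_coord eq_sym (negbTE ba) setDDl setUC -setDDl -/S in E2.
have := bA j a0 isT; have := bA j b isT; rewrite /bad E1 E2.
have wa := w_le j a0; have wb := w_le j b; have wab := w_a0 j b.
have W := gap_width gp; have LH := gap_LH gp.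
set u := Pr w (slice A j a0); set v := Pr w (slice A j b).
have u0 : 0 <= u by exact: Pr_ge0.
have v0 : 0 <= v by exact: Pr_ge0.
have wb0 : 0 <= w j b := w_prob.1 j b.
move=> h1 h2.
have uv : crossing full (slice A j b) (slice A j a0) by apply: crossing_slice.
have H0 : 0 <= H by apply: ltW; apply: lt_trans LH; exact: gap_L0 gp.
have LHp : p ^+ 2 <= (1 - w j a0) * (H - L).
  by apply: (le_trans W); rewrite ler_wpM2r; lra.
have bv : p ^+ 2 < w j b * v by lra.
have bu : p ^+ 2 < w j a0 * u.
  have : (1 - w j a0) * H <= (1 - w j b) * H by rewrite ler_wpM2r; lra.
  lra.
have up : p < u by rewrite expr2 in bu; nra.
have vp : p < v by rewrite expr2 in bv; nra.
have := crossing_not_both w_prob (fun i a _ => w_le i a) (gap_eta gp) p0 p1 (gap_eq gp) uv (ltW up).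
by rewrite leNgt vp.
Qed.

Lemma exists_compressed A0 : all_bad full w om H A0 ->
  exists2 A, all_bad full w om H A & forall x j, x \in A -> upd x j a0 \in A.
Proof.
move=> Q0.
pose T := (I * {b : V | b != a0})%type.
pose sg (k : T) := swap_value k.1 (val k.2).
pose P (k : T) x := x k.1 == a0.
pose pot x := #|[set i | x i == a0]|.
have [||||A QA st] := @symm_stable _ T sg P pot (all_bad full w om H) A0 _ _ _ _ Q0.
- by move=> [j [b ba]]; exact: swap_valueK.
- by move=> [j [b ba]] x; rewrite /P /sg /= => /eqP xj; rewrite swap_value_a0// xj eq_sym.
- move=> [j [b ba]] x; rewrite /P /sg /= swap_value_a0// => /eqP xj.
  apply: proper_card; apply/properP; split; last first.
    by exists j; rewrite !inE ?updE ?eqxx xj ?tpermR ?eqxx// .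
  apply/subsetP => i; rewrite !inE updE; case: (eqVneq i j) => // ->.
  by rewrite xj (negbTE ba).
- by move=> [j [b ba]] A; exact: all_bad_compress.
exists A => // x j xA; have [xj|xj] := eqVneq (x j) a0; first by rewrite -xj upd_id.
have := st (j, exist (fun b => b != a0) (x j) xj) x xA.
by rewrite /P /sg /= swap_value_a0// eqxx /swap_value tpermR; apply.
Qed.

(** Replace [x] by [a0] wherever it agrees with [y]. The result is still in [A], so it meets [y],
    which is possible only where both were [a0]. *)
Lemma compressed_meets A x y : crossing full A A ->
  (forall x j, x \in A -> upd x j a0 \in A) -> x \in A -> y \in A ->
  exists i, x i = a0 /\ y i = a0.
Proof.
move=> /crossingP AA st xA yA.
pose F K := foldr (fun i z => upd z i a0) x K.
have FA K : F K \in A by elim: K => [//|i K IH] /=; exact: st.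
have FE K i : F K i = if i \in K then a0 else x i.
  by elim: K => [//|k K IH]; rewrite /F /= updE -/(F K) inE IH; case: eqP.
have /existsP[i] := AA _ _ (FA (enum [set i | x i == y i])) yA.
rewrite andbT FE mem_enum inE; case: ifP => [/eqP xy /eqP ya|-> //].
by exists i; rewrite xy -ya.
Qed.

End Compression.

(** * Shifting *)

Section Pushforward.
Variables (R : realType) (I V V' : finType) (w : I -> V -> R) (h : V -> V').

Definition push_weights i c : R := \sum_(a | h a == c) w i a.
Definition push_fun (x : {ffun I -> V}) : {ffun I -> V'} := [ffun i => h (x i)].

Lemma Pr_push (F : {set {ffun I -> V'}}) :
  Pr push_weights F = Pr w (push_fun @^-1: F).
Proof.
rewrite /Pr [RHS](partition_big push_fun (mem F)) /=; last by move=> x; rewrite inE.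
apply: eq_bigr => z zF; rewrite /wt /push_weights bigA_distr_big_dep.
apply: eq_bigl => x.
have -> : (x \in push_fun @^-1: F) = (push_fun x \in F) by rewrite inE.
have [xz|xz] := eqVneq (push_fun x) z.
  by rewrite xz zF /=; apply/familyP => i; rewrite unfold_in -xz ffunE.
rewrite andbF; apply: contra_neqF xz => /familyP H.
by apply/ffunP => i; rewrite ffunE; apply/eqP; exact: H.
Qed.

Lemma push_prob : prob_weights w -> prob_weights push_weights.
Proof.
move=> [w0 w1]; split => [i c|i]; first by rewrite sumr_ge0.
by rewrite -(w1 i) [RHS](partition_big h xpredT).
Qed.

End Pushforward.

Section Shift.
Variables (R : realType) (n : nat) (w : 'I_n -> bool -> R).
Variables (p eta om L H : R).
Hypothesis gp : gap_params p eta om L H.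
Hypothesis w_prob : prob_weights w.
Hypothesis w_le : forall i, w i true <= p.
Hypothesis w_nondec : forall i j : 'I_n, (i <= j)%N -> w i true <= w j true.
Local Notation X := {ffun 'I_n -> bool}.
Local Notation D := (fun (_ : 'I_n) (b : bool) => b).
Implicit Types (A : {set X}) (x y : X).

Let p0 := gap_p0 gp.
Let p2 := gap_p2 gp.
Let p1 : p < 1. Proof. by apply: (le_lt_trans p2); lra. Qed.
Let wD i a : D i a -> w i a <= p. Proof. by case: a. Qed.

Lemma w_falseE i : w i false = 1 - w i true.
Proof. by have := w_prob.2 i; rewrite big_bool /= => <-; rewrite addrAC subrr add0r. Qed.

Lemma Pr_bool A j :
  Pr w A = w j true * Pr w (slice A j true) + (1 - w j true) * Pr w (slice A j false).
Proof. by rewrite (Pr_slice w_prob A j) big_bool w_falseE. Qed.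

Lemma Pr_off_true A j :
  Pr w (A :\: coord j true) = (1 - w j true) * Pr w (slice A j false).
Proof. by rewrite Pr_off// (big_pred1 false) ?w_falseE//; case. Qed.

Lemma slice_slice A i j a b : i != j ->
  slice (slice A i a) j b = slice (slice A j b) i a.
Proof.
move=> ij; apply/setP => x; rewrite !inE; congr (_ \in A); apply/ffunP => k.
by rewrite !updE; case: (eqVneq k i) => // ->; rewrite (negbTE ij).
Qed.

Definition swap_coord (i j : 'I_n) x : X := [ffun k => x (tperm i j k)].
Definition up_pair (i j : 'I_n) x := x j && ~~ x i.

Lemma swap_coordK i j : involutive (swap_coord i j).
Proof. by move=> x; apply/ffunP => k; rewrite !ffunE tpermK. Qed.

Lemma up_pair_swap i j x : up_pair i j (swap_coord i j x) = x i && ~~ x j.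
Proof. by rewrite /up_pair !ffunE tpermL tpermR. Qed.

Lemma swap_coordE i j x : x i -> ~~ x j ->
  swap_coord i j x = upd (upd x i false) j true.
Proof.
move=> xi xj; apply/ffunP => k; rewrite !ffunE.
case: tpermP => [->|->|/eqP/negbTE -> /eqP/negbTE ->] //; last by rewrite eqxx.
by rewrite eqxx (negbTE xj); case: eqP => // ij; move: xj; rewrite -ij xi.
Qed.

(** Two moved points share [j]. If a moved [x] missed an unmoved [y], then [y] would avoid [j]; if
    [y] contains [i], its swap is also in [A] and misses the swap of [x], and otherwise [y] itself
    does. *)
Lemma crossing_shift i j A : i != j -> crossing D A A ->
  crossing D (symm (swap_coord i j) (up_pair i j) A) (symm (swap_coord i j) (up_pair i j) A).
Proof.
move=> ij /crossingP AA; set sA := symm _ _ A.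
have psg x : up_pair i j x -> ~~ up_pair i j (swap_coord i j x).
  by rewrite up_pair_swap => /andP[-> _]; rewrite andbF.
have mixed x y : up_pair i j x -> swap_coord i j x \in A -> y \in sA -> y \in A ->
    meets D x y.
  move=> /andP[xj xi] sx ysA yA; apply: contraT => /existsPn nm.
  have {}nm k : x k -> ~~ y k by move=> xk; have := nm k; rewrite xk andbT; case: (y k).
  have yj := nm j xj.
  have [yi|yi] := boolP (y i).
    have yP : up_pair i j (swap_coord i j y) by rewrite up_pair_swap yi.
    have [_ sy] := symm_both psg ysA yP.
    have /existsP[k] := AA _ _ sx sy; rewrite !ffunE => /andP[/eqP xy xk].
    by have := nm _ xk; rewrite -xy xk.
  have /existsP[k] := AA _ _ sx yA; rewrite !ffunE.
  case: tpermP => [->|->|_ _].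
  - by rewrite xj (negbTE yi).
  - by rewrite (negbTE xi) andbF.
  - by case xk : (x k); rewrite ?andbF// (negbTE (nm k xk)).
apply/crossingP => x y xs ys.
have [xA|[xP sx]] := symmP xs; have [yA|[yP sy]] := symmP ys.
- exact: AA.
- by rewrite meetsC; exact: mixed.
- exact: mixed.
- by apply/existsP; exists j; case/andP: xP => -> _; case/andP: yP => -> _.
Qed.

Lemma wt_swap_coord (i j : 'I_n) x : (i < j)%N -> up_pair i j (swap_coord i j x) ->
  wt w x <= wt w (swap_coord i j x).
Proof.
move=> ij; rewrite up_pair_swap => /andP[xi xj]; rewrite swap_coordE//.
have ji : j != i by rewrite -val_eqE /= gtn_eqF.
rewrite /wt (bigD1 i)//= [leRHS](bigD1 i)//= (bigD1 j)//= [X in _ <= _ * X](bigD1 j)//=.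
rewrite !updE eqxx (negbTE ji) eq_sym (negbTE ji) eqxx xi (negbTE xj) !w_falseE !mulrA.
rewrite [X in _ <= _ * X](eq_bigr (fun k => w k (x k))); last first.
  by move=> k /andP[/negbTE ki /negbTE kj]; rewrite !updE ki kj.
rewrite ler_wpM2r//; first by apply: prodr_ge0 => k _; exact: w_prob.1.
have := w_nondec (ltnW ij); lra.
Qed.

Lemma all_bad_shift (i j : 'I_n) A : (i < j)%N -> all_bad D w om H A ->
  all_bad D w om H (symm (swap_coord i j) (up_pair i j) A).
Proof.
move=> ij /all_badP[AA mA bA]; set sA := symm _ _ A.
have ij' : i != j by rewrite -val_eqE /= ltn_eqF.
have sK := @swap_coordK i j.
have wt_sg x := @wt_swap_coord i j x ij.
have sAA : crossing D sA sA by exact: crossing_shift.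
have msA : om < Pr w sA by apply: lt_le_trans mA _; exact: Pr_symm.
apply/all_badP; split => // k a; case: a => // _.
(* Moves fill [j] and empty [i], so only the part at [j] can gain points. *)
have [->|kj] := eqVneq k j; last first.
  apply: lt_le_trans (bA k true isT) _; apply: Pr_symm_off => // x.
  rewrite up_pair_swap => /andP[xi xj]; rewrite !inE swap_coordE// !updE (negbTE kj).
  by case: (k == i).
apply: contraT => nb.
have := not_bad_off gp w_prob wD sAA msA (w_le j) nb.
have wj := w_le j; have wi := w_le i; have wij := w_nondec (ltnW ij).
have w1 (k' : 'I_n) : 0 < 1 - w k' true by rewrite subr_gt0 (le_lt_trans (w_le k') p1).
rewrite Pr_off_true ltr_pM2l// (Pr_bool _ i).
have b1 : H < Pr w (slice A j false).
  by have := bA j true isT; rewrite /bad Pr_off_true ltr_pM2l.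
have b2 : H < Pr w (slice A i false).
  by have := bA i true isT; rewrite /bad Pr_off_true ltr_pM2l.
rewrite (Pr_bool _ i) in b1; rewrite (Pr_bool _ j) in b2.
rewrite [slice (slice A i false) j true]slice_slice// in b2.
rewrite [slice (slice A i false) j false]slice_slice// in b2.
have : Pr w (slice (slice A j false) i false) <= Pr w (slice (slice sA j false) i false).
  apply: Pr_mono => //; apply/subsetP => x; rewrite !inE => xA.
  by rewrite up_pair_swap /up_pair !updE !eqxx (negbTE ij') xA.
move: b1 b2.
have u0 A' : 0 <= Pr w A' by exact: Pr_ge0.
have cr : crossing D (slice (slice A j false) i true) (slice (slice A j true) i false).
  by apply: crossing_slice => //; exact: crossing_slice.
have := crossing_not_both w_prob wD (gap_eta gp) p0 p1 (gap_eq gp) cr.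
move: (u0 (slice (slice A j false) i true)) (u0 (slice (slice A j true) i false))
  (u0 (slice (slice A j false) i false)) (u0 (slice (slice sA j false) i true)).
have W := gap_width gp; have wi0 := w_prob.1 i true; have wj0 := w_prob.1 j true.
(* [a], [b], [c] are the slices of [A] containing only [i], only [j], neither of them. If badness at
   [j] were lost, [c] would be small; badness of [A] at [j] and at [i] would then push [a] and [b]
   above [p], although these slices cross-intersect. *)
set a := Pr w _; set b := Pr w _; set c := Pr w _; set d := Pr w (slice (slice sA j false) i true).
set e := Pr w _.
move=> a0 b0 c0 d0 cr' h1 h2 ce h3.
have LHp : p ^+ 2 <= H - L by have := gap_LH gp; nra.
have cL : (1 - w i true) * c < L.
  have : 0 <= w i true * d by exact: mulr_ge0.
  have : (1 - w i true) * c <= (1 - w i true) * e by rewrite ler_wpM2l// ltW.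
  lra.
have cL' : (1 - w j true) * c <= (1 - w i true) * c by rewrite ler_wpM2r//; lra.
have pa : p < a.
  have : p ^+ 2 < w i true * a by lra.
  rewrite expr2; nra.
have pb : p < b.
  have : p ^+ 2 < w j true * b by lra.
  rewrite expr2; nra.
by have := cr' (ltW pb); lra.
Qed.

(** The cut-off [k] confines the condition to the first [k] coordinates, so that coordinates can be
    peeled off from the end inside one ambient space. *)
Definition shifted (k : nat) A := forall x (i j : 'I_n),
  x \in A -> (i < j < k)%N -> x i -> ~~ x j -> upd (upd x i false) j true \in A.

Lemma exists_shifted A0 : all_bad D w om H A0 ->
  exists2 A, all_bad D w om H A & shifted n A.
Proof.
move=> Q0; pose T := {q : 'I_n * 'I_n | (q.1 < q.2)%N}.
pose sg (k : T) := swap_coord (val k).1 (val k).2.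
pose P (k : T) := up_pair (val k).1 (val k).2.
(* Each shift replaces an index by a larger one. *)
pose pot x := (\sum_(k | x k) k)%N.
have [||||A QA st] := @symm_stable _ T sg P pot (all_bad D w om H) A0 _ _ _ _ Q0.
- by move=> [[i j] ij]; exact: swap_coordK.
- by move=> [[i j] ij] x; rewrite /P /sg /= up_pair_swap => /andP[-> _]; rewrite andbF.
- move=> [[i j] ij] x; rewrite /P /sg /= up_pair_swap => /andP[xi xj].
  have -> : pot (swap_coord i j x) = (\sum_(k | x k) tperm i j k)%N.
    rewrite /pot (reindex_inj (@perm_inj _ (tperm i j))) /=.
    by apply: eq_bigl => k; rewrite ffunE tpermK.
  rewrite /pot (bigD1 i)//= [ltnRHS](bigD1 i)//= tpermL -addSn leq_add//.
  rewrite leq_eqVlt; apply/orP; left; apply/eqP; apply: eq_bigr => k /andP[xk ki].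
  rewrite tpermD//; first by rewrite eq_sym.
  by apply: contraTneq xk => <-.
- by move=> [[i j] ij] A; exact: all_bad_shift.
exists A => // x i j xA /andP[ij _] xi xj.
have := st (exist (fun q : 'I_n * 'I_n => (q.1 < q.2)%N) (i, j) ij) x xA.
by rewrite /P /sg /= up_pair_swap xi xj swap_coordE//; apply.
Qed.

(** * Shifted families with large pairwise intersections *)

Definition common (k : nat) x y := [set i : 'I_n | [&& (i < k)%N, x i & y i]].
Definition inter (k s : nat) A :=
  forall x y, x \in A -> y \in A -> (s <= #|common k x y|)%N.

Lemma commonS_upd (j : 'I_n) x y a b :
  common j.+1 (upd x j a) (upd y j b) = common j x y :|: [set k | (k == j) && a && b].
Proof.
apply/setP => k; rewrite !inE !updE ltnS leq_eqVlt.
have [->|kj] := eqVneq k j; first by rewrite eqxx ltnn.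
by rewrite val_eqE (negbTE kj) orbF.
Qed.

Lemma shifted_slice (j : 'I_n) a A : shifted j.+1 A -> shifted j (slice A j a).
Proof.
move=> sA x i k; rewrite !inE => xA /andP[ik kj] xi xk.
have kj' : k != j by rewrite -val_eqE /= ltn_eqF.
have ij' : i != j by rewrite -val_eqE /= ltn_eqF// (ltn_trans ik).
have := sA _ i k xA; rewrite ik ltnS (ltnW kj) !updE (negbTE kj') (negbTE ij').
move=> /(_ isT xi xk); congr (_ \in A); apply/ffunP => l; rewrite !updE.
have [->|//] := eqVneq l j.
by rewrite eq_sym (negbTE kj') eq_sym (negbTE ij').
Qed.

Lemma inter_slice_true (j : 'I_n) s A : inter j.+1 s.+1 A -> inter j s (slice A j true).
Proof.
move=> iA x y; rewrite !inE => xA yA; have := iA _ _ xA yA.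
rewrite commonS_upd => /leq_trans h; rewrite -ltnS; apply: h.
have -> : [set k | (k == j) && true && true] = [set j].
  by apply/setP => k; rewrite !inE !andbT.
by rewrite (leq_trans (leq_card_setU _ _))// cards1 addn1.
Qed.

(* If two members meet in exactly [s] coordinates, shifting one of these coordinates of one
   of them to [j], where the other one vanishes, leaves only [s - 1]. *)
Lemma inter_slice_false (j : 'I_n) s A : shifted j.+1 A -> inter j.+1 s.+1 A ->
  inter j s.+2 (slice A j false).
Proof.
move=> sA iA x y; rewrite !inE => xA yA; have := iA _ _ xA yA.
rewrite commonS_upd (_ : [set k | _] = set0) ?setU0; last first.
  by apply/setP => k; rewrite !inE !andbF.
rewrite leq_eqVlt => /orP[/eqP cE|//].
have [i] : exists i, i \in common j x y by apply/set0Pn; rewrite -card_gt0 -cE.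
move=> /[dup] ic; rewrite inE => /and3P[ij xi yi].
have ij' : i != j by rewrite -val_eqE /= ltn_eqF.
have x'A : upd (upd (upd x j false) i false) j true \in A.
  by apply: sA => //; rewrite ?ij ?ltnS ?leqnn// !updE ?eqxx// (negbTE ij').
have := iA _ _ x'A yA; rewrite cE leqNgt => /negP[].
apply: proper_card; apply/properP; split; last first.
  by exists i => //; rewrite !inE !updE (negbTE ij') eqxx andbF.
apply/subsetP => k; rewrite !inE !updE ltnS.
have [->|kj] := eqVneq k j; first by rewrite !andbF.
by rewrite leq_eqVlt val_eqE (negbTE kj); case: eqP => // ->; rewrite ij xi.
Qed.

(** Slicing at the last coordinate lowers the intersection number by one at [true] and raises it by
    one at [false]. This is the recursion of a random walk, solved by powers of the root
    [r = p / (1 - p)] of [r = p + (1 - p) r^2]. *)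
Lemma shifted_inter_le k s A : (k <= n)%N -> shifted k A -> inter k s.+1 A ->
  Pr w A <= p * (p / (1 - p)) ^+ s.
Proof.
have p1' : 0 < 1 - p by rewrite subr_gt0.
set r := p / (1 - p).
have r0 : 0 <= r by rewrite divr_ge0// ltW.
have rE : r = p + p * r by rewrite /r; field; rewrite gt_eqF.
have r1 : r <= 1 by rewrite ler_pdivrMr// mul1r; have := p2; lra.
have base k' A' : inter k' 1 A' -> Pr w A' <= p * r ^+ 0.
  move=> iA; rewrite mulr1.
  apply: (intersecting_le w_prob wD (gap_eta gp) p0 p1 (gap_eq gp)).
  apply/crossingP => x y xA yA; have := iA x y xA yA; rewrite card_gt0 => /set0Pn[i].
  by rewrite inE => /and3P[_ xi yi]; apply/existsP; exists i; rewrite xi yi.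
elim: k s A => [|k IH] [|s] A kn shA iA; [exact: base iA | | exact: base iA |].
  have -> : A = set0.
    apply/eqP; apply: contraT => /set0Pn[x xA]; have := iA x x xA xA.
    have -> : common 0 x x = set0 by apply/setP => i; rewrite !inE.
    by rewrite cards0.
  by rewrite Pr_set0 mulr_ge0 ?exprn_ge0 ?(ltW p0).
pose j := Ordinal kn.
have h1 := IH s _ (ltnW kn) (@shifted_slice j true A shA) (@inter_slice_true j _ A iA).
have h2 := IH s.+2 _ (ltnW kn) (@shifted_slice j false A shA) (@inter_slice_false j _ A shA iA).
rewrite (Pr_bool A j).
have wj := w_le j; have wj0 := w_prob.1 j true.
have q0 : 0 <= p * r ^+ s by rewrite mulr_ge0 ?exprn_ge0 ?(ltW p0).
have -> : p * r ^+ s.+1 = p * r ^+ s * r by rewrite exprS; ring.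
have {}h2 : Pr w (slice A j false) <= p * r ^+ s * (r * r) by rewrite !exprS in h2; lra.
move: h1 h2 q0; set q := p * r ^+ s; set a := Pr w _; set b := Pr w _ => h1 h2 q0.
have g1 : w j true * a <= w j true * q by rewrite ler_wpM2l.
have g2 : (1 - w j true) * b <= (1 - w j true) * (q * (r * r)).
  by rewrite ler_wpM2l// subr_ge0 (le_trans wj)// ltW.
(* Since [r <= 1], a step probability below [p] only lowers the bound. *)
have g3 : w j true * (1 - r * r) <= p * (1 - r * r).
  by rewrite ler_wpM2r// subr_ge0; nra.
have g4 : p * (1 - r * r) + r * r = r by nra.
have g5 : q * (w j true * (1 - r * r) + r * r) <= q * r by rewrite ler_wpM2l//; lra.
lra.
Qed.

(** After shifting, the slice at [false] of the last coordinate is 2-intersecting, so its measure is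
    at most [p^2 / (1 - p) <= H - L], whereas badness puts it above [H]. *)
Lemma no_all_bad_bool (j : 'I_n) A : j.+1 = n -> ~~ all_bad D w om H A.
Proof.
move=> jn; apply/negP => /exists_shifted[{}A /all_badP[/crossingP AA _ bA] shA].
have iA : inter j.+1 1 A.
  move=> x y xA yA; have /existsP[i /andP[/eqP xy xi]] := AA x y xA yA.
  by rewrite card_gt0; apply/set0Pn; exists i; rewrite inE jn ltn_ord -xy xi.
rewrite -jn in shA.
have := shifted_inter_le (ltnW (ltn_ord j)) (@shifted_slice j false A shA)
  (inter_slice_false shA iA).
have p1' : 0 < 1 - p by rewrite subr_gt0.
have := bA j true isT; rewrite /bad Pr_off_true ltr_pM2l; last first.
  by rewrite subr_gt0 (le_lt_trans (w_le j) p1).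
have : p * (p / (1 - p)) <= H - L.
  by rewrite mulrA ler_pdivrMr// mulrC [leRHS]mulrC -expr2 (gap_width gp).
have := gap_L0 gp; rewrite expr1; lra.
Qed.

End Shift.

(** If all parts were bad, compress and record only where a member equals [a0]. The preimage of the
    recorded family contains the compressed one, so measure and badness survive, contradicting the
    two-valued case. *)
Lemma exists_not_bad (R : realType) (n : nat) (V : finType) (w : 'I_n.+1 -> V -> R) (a0 : V)
    (p eta om L H : R) (A : {set {ffun 'I_n.+1 -> V}}) :
  gap_params p eta om L H -> prob_weights w -> (forall i a, w i a <= p) ->
  (forall i a, w i a <= w i a0) ->
  (forall i j : 'I_n.+1, (i <= j)%N -> w i a0 <= w j a0) ->
  crossing (fun _ _ => true) A A -> om < Pr w A ->
  exists j a, ~~ bad w H A j a.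
Proof.
move=> gp wP wle wa0 wnd AA mA.
suff nb : ~~ all_bad (fun _ _ => true) w om H A.
  move: nb; rewrite /all_bad AA mA /= => /forallPn[j /forallPn[a nb]].
  by exists j, a.
apply/negP => /(exists_compressed gp wP wle wa0)[{AA mA}A Q st].
have /all_badP[AA mA bA] := Q.
pose h a := a == a0; pose w' := push_weights w h.
have w'E i : w' i true = w i a0 by rewrite /w' /push_weights (big_pred1 a0)// => a; rewrite eqb_id.
pose F := [set push_fun h x | x in A].
have AF : A \subset push_fun h @^-1: F.
  by apply/subsetP => x xA; rewrite inE imset_f.
suff : all_bad (fun _ b => b) w' om H F.
  apply/negP; apply: (@no_all_bad_bool _ _ w' p eta om L H gp _ _ _ ord_max) => //.
  - exact: push_prob.
  - by move=> i; rewrite w'E.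
  - by move=> i j ij; rewrite !w'E wnd.
apply/all_badP; split.
- apply/crossingP => _ _ /imsetP[x xA ->] /imsetP[y yA ->].
  have [i [xi yi]] := compressed_meets AA st xA yA.
  by apply/existsP; exists i; rewrite !ffunE /h xi yi !eqxx.
- by rewrite Pr_push; apply: lt_le_trans mA _; exact: Pr_mono.
move=> j a; case: a => // _; rewrite /bad w'E Pr_push.
apply: lt_le_trans (bA j a0 isT) _; apply: Pr_mono => //; apply/subsetP => x.
rewrite in_setD => /andP[xj xA]; rewrite inE in_setD imset_f// andbT.
by move: xj; rewrite !inE ffunE eqb_id.
Qed.

(** The first conclusion becomes the bound on [t_j], the second the bound off the part. With [y] the
    [eta]-th root of [x], the ratio [x / y] grows with [x] and so is at most its value [rho] at
    [L]. *)
Lemma off_bound (R : realType) (p eta om L H w v x m : R) :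
  gap_params p eta om L H ->
  L / L `^ eta^-1 <= om - L ->
  0 <= 1 - (1 - p) / p * (L / L `^ eta^-1) ->
  1 <= 4 * (1 - (1 - p) / p * (L / L `^ eta^-1)) `^ eta ->
  0 <= w <= p -> v <= 1 -> 0 < x < L -> x <= (1 - v) `^ eta ->
  m = w * v + (1 - w) * x -> om < m ->
  m < w /\ (1 - w) * x < 4 * (1 - m / p) `^ eta.
Proof.
move=> gp; set l := L `^ _; set rho := L / l; set c := 1 - _ => rho_le c0 c4.
move=> w01 v1 /andP[x0 xL] xv mE omm.
have p0 := gap_p0 gp; have p2 := gap_p2 gp; have LH := gap_LH gp.
have Hom := gap_Hom gp; have e1 := gap_eta gp; have L0 := gap_L0 gp.
have e0 : 0 < eta by exact: lt_le_trans ltr01 e1.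
have [m1 m2] := off_ratio_le gp w01 v1 (ltW x0) xv mE.
have {}m2 := m2 (ltac:(lra)).
set y := x `^ eta^-1 in m1 m2.
have y0 : 0 < y by exact: powR_gt0.
have l0 : 0 < l by exact: powR_gt0.
have yE : y `^ eta = x by rewrite powR_invK// ltW.
have yl : y <= l by apply: powR_le; rewrite ?invr_ge0 ?(ltW e0) ?(ltW x0) ?(ltW xL).
have rho0 : 0 < rho by rewrite divr_gt0.
have xy : x <= y * rho.
  rewrite -yE -(mulr_powRB1 (ltW y0) e0) ler_wpM2l ?(ltW y0)//.
  have -> : rho = l `^ (eta - 1).
    rewrite /rho -[L in L / _](powR_invK e0 (ltW L0)) -/l -(mulr_powRB1 (ltW l0) e0).
    by rewrite mulrC mulKf ?gt_eqF.
  by apply: powR_le; rewrite ?subr_ge0 ?(ltW y0).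
case/andP: w01 => w0 wp.
clearbody y; clear mE v1 xv.
have wy0 : 0 <= w * y by rewrite mulr_ge0 ?(ltW y0).
have wx0 : 0 <= w * x by rewrite mulr_ge0 ?(ltW x0).
(* [m1] and [x < L] give [w > om - L >= rho]; hence [x < w * y], and [m1] then yields [m < w]. *)
have rw : rho < w by lra.
have ryw : rho * y < w * y by rewrite ltr_pM2r.
split; first by lra.
have wx : (1 - w) * x < x.
  have : 0 < w * x by rewrite mulr_gt0// (lt_trans rho0).
  by lra.
apply: (lt_le_trans wx).
(* Obtained from [m2]; its [eta]-th power gives a lower bound [x * c^eta], and [c^eta >= 1/4]. *)
have cE : y * c <= 1 - m / p.
  have -> : 1 - m / p = (p - m) / p by rewrite mulrBl divff// gt_eqF.
  rewrite ler_pdivlMr//.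
  have -> : y * c * p = y * p - (1 - p) * (y * rho) by rewrite /c; field; rewrite gt_eqF.
  have : (1 - p) * x <= (1 - p) * (y * rho) by rewrite ler_wpM2l//; lra.
  lra.
have yc0 : 0 <= y * c by rewrite mulr_ge0 ?(ltW y0).
have := powR_le (ltW e0) yc0 cE; rewrite powRM ?(ltW y0)// yE => h.
have : x <= 4 * (x * c `^ eta).
  by rewrite mulrCA -[leLHS]mulr1 ler_wpM2l ?(ltW x0).
lra.
Qed.

(** * The thresholds *)

Section Thresholds.
Variable R : realType.

Lemma le3_natr (t : nat) : (3 <= t)%N -> (3 : R) <= t%:R.
Proof. by move=> t3; rewrite (ler_nat R 3). Qed.

Lemma eta_ge1 (t : nat) : (3 <= t)%N -> 1 <= eta R t.
Proof.
move=> /le3_natr t3; have t1 : 0 < (t%:R : R) - 1 by lra.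
have q1 : 1 < (t%:R : R) / (t%:R - 1) by rewrite ltr_pdivlMr//; lra.
rewrite /eta ler_pdivlMr ?ln_gt0// mul1r ler_ln ?posrE ?(lt_trans ltr01 q1)//; last by lra.
by rewrite ler_pdivrMr//; nra.
Qed.

Lemma powR_eta (t : nat) : (3 <= t)%N -> (1 - 1 / t%:R) `^ eta R t = 1 / t%:R.
Proof.
move=> /le3_natr t3; have t1 : 0 < (t%:R : R) - 1 by lra.
have t0 : 0 < (t%:R : R) by lra.
have q1 : 1 < (t%:R : R) / (t%:R - 1) by rewrite ltr_pdivlMr//; lra.
have -> : (1 : R) - 1 / t%:R = (t%:R / (t%:R - 1))^-1.
  by field; rewrite !gt_eqF.
apply: ln_inj; rewrite ?posrE ?powR_gt0 ?invr_gt0 ?divr_gt0//.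
rewrite ln_powR lnV ?posrE ?divr_gt0// div1r lnV ?posrE// /eta mulrN divfK//.
by rewrite gt_eqF// ln_gt0.
Qed.

Lemma bernoulli_sub (x : R) k : 0 <= x <= 1 -> 1 - k%:R * x <= (1 - x) ^+ k.
Proof.
move=> /andP[x0 x1]; elim: k => [|k IH]; first by rewrite mul0r subr0.
rewrite exprS -natr1.
have : (1 - x) * (1 - k%:R * x) <= (1 - x) * (1 - x) ^+ k by rewrite ler_wpM2l// subr_ge0.
have : 0 <= k%:R * (x * x) by rewrite mulr_ge0 ?mulr_ge0.
lra.
Qed.

(** By Bernoulli, the base to the power [t - 2] is at least [1 - 1/t]; taking [eta]-th powers, it
    remains that [t <= 4^(t-2)]. *)
Lemma powR_eta_quarter (t : nat) : (3 <= t)%N ->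
  1 <= 4 * (1 - (t%:R - 1)^-2) `^ eta R t.
Proof.
move=> t3; have t3' := le3_natr t3; have e1 := eta_ge1 t3.
have [k tk] : exists k, t = k.+3 by exists (t - 3)%N; rewrite -addn3 subnK.
have t1 : 0 < (t%:R : R) - 1 by lra.
set c := 1 - _.
have x01 : 0 <= ((t%:R : R) - 1)^-2 <= 1.
  by rewrite invr_ge0 exprn_ge0 ?(ltW t1)//= invf_le1 ?exprn_gt0// exprn_ege1//; lra.
have c0 : 0 <= c by rewrite subr_ge0; case/andP: x01.
have ck : 1 - 1 / t%:R <= c ^+ k.+1.
  apply: le_trans (bernoulli_sub k.+1 x01); rewrite lerD2l lerN2.
  rewrite ler_pdivrMr ?exprn_gt0// mulrAC ler_pdivlMr; last by lra.
  by rewrite tk -!natr1; lra.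
have z0 := powR_ge0 c (eta R t).
rewrite -ler_pdivrMl// mulr1 -(ler_pXn2r (ltn0Sn k)) ?nnegrE ?invr_ge0//.
rewrite -powRX//; apply: (@le_trans _ _ ((1 - 1 / t%:R) `^ eta R t)); last first.
  apply: powR_le => //; first exact: le_trans ler01 e1.
  by rewrite subr_ge0 ler_pdivrMr; lra.
rewrite powR_eta// exprVn div1r lef_pV2 ?posrE ?exprn_gt0//; last by lra.
rewrite -natrX ler_nat tk; elim: (k) => // m IH.
by rewrite expnS; lia.
Qed.


(** Powers of [1/t] have explicit [eta]-th roots, which is why [L] is chosen among them. *)
Lemma powR_eta_inv (t k : nat) : (3 <= t)%N ->
  ((1 / t%:R) ^+ k) `^ (eta R t)^-1 = (1 - 1 / t%:R) ^+ k.
Proof.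
move=> t3; have e0 : 0 < eta R t by exact: lt_le_trans ltr01 (eta_ge1 t3).
have q0 : (0 : R) <= 1 - 1 / t%:R.
  by have := le3_natr t3 => t3'; rewrite subr_ge0 ler_pdivrMr; lra.
by rewrite -{1}(powR_eta t3) -powRX// powR_Kinv// exprn_ge0.
Qed.

(** Turns rational inequalities between powers into estimates of [eta]-th powers. *)
Lemma powR_eta_succ (t : nat) : (3 <= t)%N ->
  (t%:R / (t%:R - 1)) `^ eta R t = t%:R :> R.
Proof.
move=> t3; have t3' := le3_natr t3.
have t0 : (t%:R : R) != 0 by rewrite gt_eqF//; lra.
have t1 : (t%:R : R) - 1 != 0 by rewrite gt_eqF//; lra.
have q0 : (0 : R) <= 1 - 1 / t%:R by rewrite subr_ge0 ler_pdivrMr; lra.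
have r0 : (0 : R) <= t%:R / (t%:R - 1) by rewrite divr_ge0//; lra.
have E : (t%:R / (t%:R - 1)) `^ eta R t * (1 / t%:R) = 1 :> R.
  rewrite -(powR_eta t3) -powRM//.
  by rewrite (_ : _ * _ = 1) ?powR1//; field; rewrite t0 t1.
have i0 : 1 / t%:R != 0 :> R by rewrite div1r invr_neq0.
by apply: (mulIf i0); rewrite E div1r divff.
Qed.

(** Beyond the gap conditions, these are the three numerical hypotheses of [off_bound]. *)
Definition thresholds (t : nat) (L H : R) :=
  let p : R := 1 / t%:R in let rho := L / L `^ (eta R t)^-1 in
  [/\ gap_params p (eta R t) (omega R t) L H, rho <= omega R t - L,
      0 <= 1 - (1 - p) / p * rho & 1 <= 4 * (1 - (1 - p) / p * rho) `^ eta R t].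

Lemma powR_le_inv (e x y : R) : 0 < e -> 0 <= x -> 0 <= y -> x <= y `^ e ->
  x `^ e^-1 <= y.
Proof.
move=> e0 x0 y0 xy; rewrite -[leRHS](powR_Kinv e0 y0).
by apply: powR_le => //; rewrite invr_ge0 ltW.
Qed.

Lemma thresholds3 : thresholds 3 (1 / 81) (5 / 27).
Proof.
have e1 : 1 <= eta R 3 by exact: eta_ge1.
have e0 : 0 < eta R 3 by exact: lt_le_trans ltr01 e1.
have ep := @powR_eta 3 isT; have es := @powR_eta_succ 3 isT.
have lE := @powR_eta_inv 3 4 isT; have E1 := @powR_eta_inv 3 1 isT.
have om : omega R 3 = 37 / 81 - 1 / 2 * (5 / 81) `^ (eta R 3)^-1.
  by rewrite /omega eqxx [1 / eta R 3]div1r.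
have q81 : (1 / 3) ^+ 1 * (5 / 27) = 5 / 81 :> R by lra.
have c78 : 1 - (1 - 1 / 3) / (1 / 3) * (1 / 81 / (16 / 81)) = 7 / 8 :> R by rewrite !invf_div; lra.
have eLN : (1 / 3) ^+ 4 = 1 / 81 :> R by lra.
have elN : (1 - 1 / 3) ^+ 4 = 16 / 81 :> R by lra.
(* [omega R 3] is exactly the gap bound at [H]; it dominates the bound [67/243] at [L] precisely
   when the root of [H] is at most [44/81]. *)
have h44 : 44 / 81 = (1 - 1 / 3) ^+ 3 * (11 / 6) :> R by lra.
have p23 : 0 <= 1 - 1 / 3 :> R by lra.
have s31 : 3 - 1 = 2 :> R by lra.
have p32 : 0 <= 3 / (3 - 1) :> R by rewrite s31; lra.
have p116 : 0 <= 11 / 6 :> R by lra.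
have p78 : 0 <= 7 / 8 :> R by lra.
have p527 : 0 <= 5 / 27 :> R by lra.
have p13 : 0 <= (1 / 3) ^+ 1 :> R by lra.
have p44 : 0 <= 44 / 81 :> R by lra.
(* Together with [n116] this yields [5 <= (11/6)^eta] after taking fifteenth roots. *)
have n5 : (5 : R) ^+ 15 <= 3 ^+ 22 by lra.
have n116 : (3 / (3 - 1)) ^+ 22 <= (11 / 6) ^+ 15 :> R by rewrite s31; lra.
have n78 : 1 - 1 / 3 <= (7 / 8) ^+ 3 :> R by lra.
have x0 : 0 <= (3 / (3 - 1)) ^+ 22 :> R by exact: exprn_ge0.
have z5 : 5 <= (11 / 6) `^ eta R 3 :> R.
  have := powR_le (ltW e0) x0 n116; rewrite powRX// es (powRX _ _ p116) => z.
  have := le_trans n5 z.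
  by rewrite ler_pXn2r ?nnegrE ?powR_ge0.
have h : (5 / 27) `^ (eta R 3)^-1 <= 44 / 81 :> R.
  apply: powR_le_inv e0 p527 p44 _.
  rewrite h44 (powRM _ (exprn_ge0 3 p23) p116) (powRX _ _ p23) ep.
  lra.
have qE : (5 / 81) `^ (eta R 3)^-1 = (1 - 1 / 3) ^+ 1 * (5 / 27) `^ (eta R 3)^-1 :> R.
  by rewrite -E1 -(powRM _ p13 p527) q81.
have y3 := powR_le (ltW e0) p23 n78.
rewrite ep (powRX _ _ p78) in y3.
have y0 := powR_ge0 (7 / 8) (eta R 3).
rewrite eLN elN in lE; rewrite qE in om.
clear -om h e1 ep lE c78 p78 y3 y0.
rewrite /thresholds lE c78.
split; [split|lra|exact: p78|].
- lra.
- lra.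
- exact: e1.
- exact: ep.
- lra.
- lra.
- lra.
- rewrite lE; lra.
- lra.
- move: y3 y0; set y := _ `^ _ => y3 y0; nra.
Qed.

Lemma thresholds4 : thresholds 4 (1 / 64) (7 / 64).
Proof.
have e1 : 1 <= eta R 4 by exact: eta_ge1.
have e0 : 0 < eta R 4 by exact: lt_le_trans ltr01 e1.
have ep := @powR_eta 4 isT; have es := @powR_eta_succ 4 isT.
have lE := @powR_eta_inv 4 3 isT; have E1 := @powR_eta_inv 4 1 isT.
have c4 := @powR_eta_quarter 4 isT.
have om : omega R 4 = 85 / 256 - 1 / 3 * (7 / 256) `^ (eta R 4)^-1.
  by rewrite /omega [1 / eta R 4]div1r.
have q256 : (1 / 4) ^+ 1 * (7 / 64) = 7 / 256 :> R by lra.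
have c89 : 1 - (1 - 1 / 4) / (1 / 4) * (1 / 64 / (27 / 64)) = 8 / 9 :> R by rewrite !invf_div; lra.
have s41 : 4 - 1 = 3 :> R by lra.
have c89' : 1 - (4 - 1) ^- 2 = 8 / 9 :> R by rewrite s41; lra.
have eLN : (1 / 4) ^+ 3 = 1 / 64 :> R by lra.
have elN : (1 - 1 / 4) ^+ 3 = 27 / 64 :> R by lra.
(* As for [t = 3]: [45/64] is the largest root of [H] for which the bound at [H], equal to
   [omega R 4], is at least the bound [40/256] at [L]. *)
have h45 : 45 / 64 = (1 - 1 / 4) ^+ 3 * (5 / 3) :> R by lra.
have p34 : 0 <= 1 - 1 / 4 :> R by lra.
have p43 : 0 <= 4 / (4 - 1) :> R by rewrite s41; lra.
have p53 : 0 <= 5 / 3 :> R by lra.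
have p764 : 0 <= 7 / 64 :> R by lra.
have p14 : 0 <= (1 / 4) ^+ 1 :> R by lra.
have p45 : 0 <= 45 / 64 :> R by lra.
have n7 : (7 : R) ^+ 2 <= 4 ^+ 3 by lra.
have n53 : (4 / (4 - 1)) ^+ 3 <= (5 / 3) ^+ 2 :> R by rewrite s41; lra.
have x0 : 0 <= (4 / (4 - 1)) ^+ 3 :> R by exact: exprn_ge0.
have z7 : 7 <= (5 / 3) `^ eta R 4 :> R.
  have := powR_le (ltW e0) x0 n53; rewrite powRX// es (powRX _ _ p53) => z.
  have := le_trans n7 z.
  by rewrite ler_pXn2r ?nnegrE ?powR_ge0.
have h : (7 / 64) `^ (eta R 4)^-1 <= 45 / 64 :> R.
  apply: powR_le_inv e0 p764 p45 _.
  rewrite h45 (powRM _ (exprn_ge0 3 p34) p53) (powRX _ _ p34) ep.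
  lra.
have qE : (7 / 256) `^ (eta R 4)^-1 = (1 - 1 / 4) ^+ 1 * (7 / 64) `^ (eta R 4)^-1 :> R.
  by rewrite -E1 -(powRM _ p14 p764) q256.
rewrite eLN elN in lE; rewrite qE in om; rewrite c89' in c4.
clear -om h e1 ep lE c89 c4.
rewrite /thresholds lE c89.
split; [split|lra|lra|exact: c4].
- lra.
- lra.
- exact: e1.
- exact: ep.
- lra.
- lra.
- lra.
- rewrite lE; lra.
- lra.
Qed.

Lemma thresholds5 (t : nat) : (5 <= t)%N ->
  thresholds t ((1 / t%:R) ^+ 3) (2 * (1 / t%:R) ^+ 2).
Proof.
move=> t5; have t3 : (3 <= t)%N by exact: leq_trans t5.
have t5' : (5 : R) <= t%:R by rewrite (ler_nat R 5).
have e1 := eta_ge1 t3; have e0 : 0 < eta R t by exact: lt_le_trans ltr01 e1.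
have ep := powR_eta t3; have lE := @powR_eta_inv t 3 t3.
have hE := @powR_eta_inv t 2 t3; have c4 := powR_eta_quarter t3.
have t0 : (t%:R : R) != 0 by rewrite gt_eqF//; lra.
have t1 : (t%:R : R) - 1 != 0 by rewrite gt_eqF//; lra.
have om : omega R t = 4 * (1 / t%:R) ^+ 2 - 3 * (1 / t%:R) ^+ 3.
  rewrite /omega (gtn_eqF (_ : 3 < t)%N) ?(gtn_eqF (_ : 4 < t)%N)//; last first.
    exact: leq_trans t5.
  by field.
have cE : 1 - (1 - 1 / t%:R) / (1 / t%:R) * ((1 / t%:R) ^+ 3 / (1 - 1 / t%:R) ^+ 3)
    = 1 - (t%:R - 1) ^- 2 :> R.
  by field; rewrite t0 t1.
have pp : 0 < 1 / t%:R :> R by rewrite divr_gt0//; lra.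
have p5 : 1 / t%:R <= 1 / 5 :> R by rewrite ler_pdivrMr; lra.
(* The root of [H] is replaced by the explicit root of half of [H], and the gap bound at [H] then
   becomes exactly [omega R t]. *)
have h : (1 - 1 / t%:R) ^+ 2 <= (2 * (1 / t%:R) ^+ 2) `^ (eta R t)^-1.
  rewrite -hE; apply: powR_le; [by rewrite invr_ge0 ltW | by rewrite exprn_ge0// ltW |].
  have : 0 <= (1 / t%:R) ^+ 2 :> R by rewrite exprn_ge0// ltW.
  lra.
have c0 : 0 <= 1 - (t%:R - 1) ^- 2 :> R.
  clear -t5'; rewrite subr_ge0 invf_le1; last by rewrite exprn_gt0//; lra.
  by rewrite exprn_ege1//; lra.
rewrite /thresholds lE cE om.
move: lE h ep pp p5; set q : R := 1 / t%:R => lE h ep pp p5.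
have q0 : 0 <= q by exact: ltW.
have q1 : 0 <= 1 - q by lra.
have q2 : 0 < q ^+ 2 by rewrite exprn_gt0.
have q3E : q ^+ 3 = q ^+ 2 * q by rewrite exprSr.
have q3 : q ^+ 3 <= q ^+ 2 * (1 / 5) by rewrite q3E ler_pM2l.
have q3' : 0 < q ^+ 3 by rewrite exprn_gt0.
have q4 : 0 <= q ^+ 4 by rewrite exprn_ge0.
split; [split| |exact: c0|exact: c4].
- exact: pp.
- lra.
- exact: e1.
- exact: ep.
- exact: q3'.
- lra.
- have : (1 - q) * (2 * q ^+ 2 - q ^+ 3) = 2 * q ^+ 2 - 3 * q ^+ 3 + q ^+ 4 by ring.
  lra.
- rewrite lE.
  have : q * (1 - (1 - q) ^+ 3) + (1 - q) * q ^+ 3 = 3 * q ^+ 2 - 2 * q ^+ 3 by ring.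
  lra.
- have : q * (1 - q) ^+ 2 <= q * (2 * q ^+ 2) `^ (eta R t)^-1 by rewrite ler_wpM2l.
  have : q * (1 - (1 - q) ^+ 2) + (1 - q) * (2 * q ^+ 2) = 4 * q ^+ 2 - 3 * q ^+ 3 by ring.
  set y := _ `^ _; lra.
have r0 : 0 < 1 - q by lra.
rewrite ler_pdivrMr ?exprn_gt0//.
(* After clearing denominators the claim is [q <= 4 (1 - q)^4], clear for [q <= 1/5]. *)
have r4 : (4 / 5) ^+ 4 <= (1 - q) ^+ 4 by rewrite ler_pXn2r ?nnegrE//; lra.
have -> : (4 * q ^+ 2 - 3 * q ^+ 3 - q ^+ 3) * (1 - q) ^+ 3 = q ^+ 2 * (4 * (1 - q) ^+ 4) by ring.
by rewrite q3E ler_pM2l//; lra.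
Qed.

Lemma exists_thresholds (t : nat) : (3 <= t)%N -> exists L H, thresholds t L H.
Proof.
rewrite leq_eqVlt => /orP[/eqP <-|]; first by do 2!eexists; exact: thresholds3.
rewrite leq_eqVlt => /orP[/eqP <-|t5]; first by do 2!eexists; exact: thresholds4.
by do 2!eexists; exact: thresholds5.
Qed.

End Thresholds.

(** * The theorem *)

Section Projection.
Variables (R : realType) (n : nat) (W : 'I_n -> finType) (V : finType).
Variable f : forall i : 'I_n, W i -> V.
Hypothesis W_gt0 : forall i, (0 < #|W i|)%N.

Definition part_weights (i : 'I_n) (a : V) : R := mu R [set v : W i | f v == a].
Definition part_fun (x : prod_vertex W) : {ffun 'I_n -> V} := [ffun i => f (x i)].

(** Fibres of [part_fun] are products of fibres of [f], so the uniform measure is pushed to a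
    product measure. *)
Lemma mu_part_preim (A : {set {ffun 'I_n -> V}}) :
  mu R (part_fun @^-1: A) = Pr part_weights A.
Proof.
have cardW : #|prod_vertex W| = (\prod_i #|W i|)%N.
  rewrite -cardsT -(eq_bigr _ (fun i _ => cardsT (W i))) -cardsXn.
  by apply: eq_card => x; rewrite !inE; apply/esym/forallP => i; rewrite inE.
rewrite /mu cardW -sum1_card (partition_big part_fun (mem A)) /=; last first.
  by move=> x; rewrite inE.
rewrite natr_sum mulr_suml; apply: eq_bigr => z zA.
rewrite /wt /part_weights /mu prodf_div -!natr_prod -cardsXn; congr (_%:R / _).
rewrite sum1_card; apply: eq_card => x; rewrite !inE unfold_in inE.
have -> : (part_fun x == z) = [forall i, x i \in [set v : W i | f v == z i]].
  apply/eqP/forallP => [<- i|H]; first by rewrite inE ffunE.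
  by apply/ffunP => i; have := H i; rewrite inE ffunE => /eqP.
rewrite andb_idl// => /forallP H; suff -> : part_fun x = z by [].
by apply/ffunP => i; have := H i; rewrite inE ffunE => /eqP.
Qed.

Lemma part_weights_prob : prob_weights part_weights.
Proof.
split=> [i a|i]; first by rewrite divr_ge0.
rewrite /part_weights /mu -mulr_suml -natr_sum.
rewrite (_ : (\sum_a _)%N = #|W i|) ?divff ?pnatr_eq0 -?lt0n//.
rewrite -sum1_card (partition_big (@f i) xpredT)//=.
by apply: eq_bigr => a _; rewrite sum1_card; apply: eq_card => v; rewrite inE.
Qed.

End Projection.

Lemma mu_mono (R : realType) (W : finType) (A B : {set W}) : A \subset B -> mu R A <= mu R B.
Proof. by move=> AB; rewrite ler_wpM2r ?invr_ge0// ler_nat subset_leq_card. Qed.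

Lemma mu_proper (R : realType) (W : finType) (A B : {set W}) : A \proper B -> mu R A < mu R B.
Proof.
move=> AB; have c0 : (0 < #|W|)%N.
  by apply: leq_trans (max_card (mem B)); apply: leq_ltn_trans (proper_card AB).
by rewrite ltr_pM2r ?invr_gt0 ?ltr0n// ltr_nat proper_card.
Qed.

Lemma Pr_coord (R : realType) (I V : finType) (w : I -> V -> R) j a :
  prob_weights w -> Pr w (coord j a) = w j a.
Proof.
move=> wP; rewrite (Pr_slice wP _ j) (bigD1 a)//= big1 => [|c /negbTE ca].
  rewrite (_ : slice _ _ _ = setT) ?Pr_setT// ?mulr1 ?addr0//.
  by apply/setP => x; rewrite !inE updE !eqxx.
rewrite (_ : slice _ _ _ = set0) ?Pr_set0 ?mulr0//.
by apply/setP => x; rewrite !inE updE eqxx ca.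
Qed.

Lemma Kpart_mu (R : realType) (u t : nat) (a : 'I_t) : (0 < u)%N ->
  mu R (Kpart u a) = 1 / t%:R.
Proof.
move=> u0; rewrite /mu (_ : Kpart u a = setX [set a] setT); last first.
  by apply/setP => -[b c]; rewrite !inE andbT.
rewrite cardsX cards1 mul1n cardsT card_ord card_prod !card_ord natrM.
by rewrite div1r invfM mulrCA divff ?mulr1// pnatr_eq0 -lt0n.
Qed.

(* The factors are indexed by 'I_n.+1, so that t_n is [t ord_max].  The case
   [I = J u a] is separated because there the strict bound on t_j fails: it
   becomes the equality t_j = t_n / (1 - eps). *)
Theorem theorem1p10 (R : realType) (n : nat) (u t : 'I_n.+1 -> nat)
    (u_gt0 : forall i : 'I_n.+1, (0 < u i)%N)
    (t_noninc : forall i j : 'I_n.+1, (i <= j)%N -> (t j <= t i)%N)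
    (t_ge3 : (3 <= t ord_max)%N)
    (I : {set Gvertex u t}) (eps : R)
    (I_indep : independent (@Gadj n.+1 u t) I)
    (I_mu : mu R I = 1 / (t ord_max)%:R * (1 - eps))
    (I_large : omega R (t ord_max) < mu R I) :
  exists (j : 'I_n.+1) (a : 'I_(t j)),
    I = J u a \/
    ((t j)%:R < (t ord_max)%:R / (1 - eps) /\
     mu R (I :\: J u a) < 4 * (eps `^ eta R (t ord_max))).
Proof.
have [L [H [gp rho_le c0 c4]]] := exists_thresholds R t_ge3.
set tn := t ord_max in t_ge3 I_mu I_large gp rho_le c0 c4 *.
set p : R := 1 / tn%:R in I_mu gp c0 c4.
set om := omega R tn in I_large gp rho_le; set e := eta R tn in gp rho_le c0 c4 *.
have p0 : 0 < p := gap_p0 gp.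
have ti_tn i : (tn <= t i)%N by apply: t_noninc; rewrite -ltnS.
have ti0 i : (0 < t i)%N by apply: leq_trans (ti_tn i); apply: leq_trans t_ge3.
(* [t ord0] is the largest number of parts, so all factors share this alphabet; surplus values get
   weight 0. *)
pose V := 'I_(t ord0).
pose f i (v : Kvertex (u i) (t i)) : V := widen_ord (t_noninc ord0 i (leq0n i)) v.1.
have W0 i : (0 < #|Kvertex (u i) (t i)|)%N by rewrite card_prod !card_ord muln_gt0 ti0 u_gt0.
pose w := part_weights R f; have wP : prob_weights w by exact: part_weights_prob.
have fE i (a : 'I_(t i)) :
    [set v | f i v == widen_ord (t_noninc ord0 i (leq0n i)) a] = Kpart (u i) a.
  by apply/setP => v; rewrite !inE.
have wE i (a : V) : w i a = if (a < t i)%N then 1 / (t i)%:R else 0.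
  rewrite /w /part_weights; case: ltnP => [ai|ia].
    by rewrite -(Kpart_mu R (Ordinal ai) (u_gt0 i)) -fE; congr (mu R _).
  rewrite (_ : [set v | _] = set0) ?/mu ?cards0 ?mul0r//.
  by apply/setP => v; rewrite !inE -val_eqE /= ltn_eqF// (leq_trans (ltn_ord _)).
have tn0 : (0 < tn)%N by exact: ti0.
have tp i : 1 / (t i)%:R <= p.
  by rewrite /p !div1r lef_pV2 ?posrE ?ltr0n ?ti0 ?tn0// ler_nat ti_tn.
have wle i a : w i a <= p by rewrite wE; case: ifP => // _; exact: ltW.
(* The value 0 is a part of every factor and has maximal weight there. *)
pose a0 : V := Ordinal (ti0 ord0).
have wa0 i : w i a0 = 1 / (t i)%:R by rewrite wE ti0.
pose A := part_fun f @: I.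
have IA : I \subset part_fun f @^-1: A.
  by apply/subsetP => x xI; rewrite inE imset_f.
have muIA : mu R I <= Pr w A by rewrite -mu_part_preim mu_mono.
have mA : om < Pr w A by exact: lt_le_trans muIA.
have AA : crossing (fun _ _ => true) A A.
  apply/crossingP => _ _ /imsetP[x xI ->] /imsetP[y yI ->].
  have /forallPn[i] := I_indep x y xI yI; rewrite negbK => /eqP xy.
  by apply/existsP; exists i; rewrite !ffunE /f xy eqxx.
have [j [a nb]] : exists j a, ~~ bad w H A j a.
  apply: (exists_not_bad (a0 := a0) gp wP wle _ _ AA mA) => [i a|i k ik].
    by rewrite wa0 wE; case: ifP => // _; rewrite divr_ge0.
  by rewrite !wa0 !div1r lef_pV2 ?posrE ?ltr0n ?ti0// ler_nat t_noninc.
(* A value of weight 0 is bad, since all of [A] counts as off it and [Pr w A > om >= H]. *)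
have aj : (a < t j)%N.
  apply: contraR nb => /negbTE aj; rewrite /bad.
  have := Pr_on_off wP A j a; rewrite wE aj mul0r add0r => <-.
  by rewrite subr0 mul1r (le_lt_trans (gap_Hom gp)).
have wja : w j a = 1 / (t j)%:R by rewrite wE aj.
have off_lt := not_bad_off gp wP (fun i c _ => wle i c) AA mA (wle j a) nb.
exists j, (Ordinal aj).
have JE : J u (Ordinal aj) = part_fun f @^-1: coord j a.
  by apply/setP => x; rewrite !inE ffunE -val_eqE.
have epsE : eps = 1 - mu R I / p by rewrite I_mu mulrC mulKf ?gt_eqF//; ring.
have e1 : 1 <= e := gap_eta gp.
have e0 : 0 < e by exact: lt_le_trans ltr01 e1.
have mu0 : 0 < mu R I.
  by apply: le_lt_trans I_large; have := gap_Hom gp; have := gap_LH gp; have := gap_L0 gp; lra.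
suff [->|[mw off]] : I = J u (Ordinal aj) \/
    mu R I < w j a /\ mu R (I :\: J u (Ordinal aj)) < 4 * eps `^ e; first by left.
  right; split => //.
  have -> : tn%:R / (1 - eps) = (mu R I)^-1.
    by rewrite I_mu /p div1r invfM invrK.
  rewrite -[(t j)%:R]invrK ltf_pV2 ?posrE ?invr_gt0 ?ltr0n//.
  by rewrite -div1r -wja.
(* If [I] is a proper subset of the part, both bounds are immediate. Otherwise [A] has positive
   measure off it, as [off_bound] requires. *)
have [IJ|nIJ] := boolP (I \subset J u (Ordinal aj)).
  have [->|IneJ] := eqVneq I (J u (Ordinal aj)); [by left | right].
  have mw : mu R I < w j a.
    by rewrite -(Pr_coord j a wP) -mu_part_preim -JE mu_proper// properEneq IneJ.
  split=> //; rewrite (_ : I :\: _ = set0) ?/mu ?cards0 ?mul0r; last first.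
    by apply/eqP; rewrite setD_eq0.
  rewrite mulr_gt0// powR_gt0// epsE subr_gt0 ltr_pdivrMr// mul1r.
  exact: lt_le_trans (wle j a).
right.
have offA : mu R (I :\: J u (Ordinal aj)) <= Pr w (A :\: coord j a).
  rewrite -mu_part_preim; apply: mu_mono; rewrite JE preimsetD.
  exact: setSD.
have off0 : 0 < Pr w (A :\: coord j a).
  apply: lt_le_trans offA; rewrite -(_ : mu R (set0 : {set Gvertex u t}) = 0).
    by apply: mu_proper; rewrite properEneq sub0set andbT eq_sym setD_eq0.
  by rewrite /mu cards0 mul0r.
have w1 : 0 < 1 - w j a.
  by rewrite subr_gt0 (le_lt_trans (wle j a))//; have := gap_p2 gp; lra.
pose x := Pr w (A :\: coord j a) / (1 - w j a).
have xE : Pr w (A :\: coord j a) = (1 - w j a) * x by rewrite /x mulrC divfK ?gt_eqF.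
have x01 : 0 < x < L.
  by rewrite divr_gt0//= ltr_pdivrMr// mulrC.
have p1 : p < 1 by have := gap_p2 gp; lra.
have xv := @Pr_off_le _ _ _ _ _ _ _ wP (fun i c _ => wle i c) e1 p0 p1 (gap_eq gp) A j a AA.
rewrite xE ler_pM2l// in xv.
have w01 : 0 <= w j a <= p by rewrite wP.1 wle.
have mE := Pr_on_off wP A j a; rewrite xE in mE.
have [mw off] := off_bound gp rho_le c0 c4 w01 (Pr_le1 wP _) x01 xv mE mA.
split; first exact: le_lt_trans mw.
(* [off_bound] speaks of [1 - Pr w A / p], which is at most [eps] because [A] is at least as large
   as [I]. *)
apply: (le_lt_trans offA); rewrite xE; apply: (lt_le_trans off).
rewrite ler_pM2l//; apply: powR_le; first exact: ltW.
  rewrite subr_ge0 ler_pdivrMr// mul1r.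
  by apply: ltW; apply: lt_le_trans mw (wle j a).
by rewrite epsE lerD2l lerN2 ler_pM2r ?invr_gt0.
Qed.
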